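(* Let $(\psi_x,\ x\in E)$ be a nonnegative infinitely divisible process with no drift and with Lévy measure $\nu$. For $\delta>0$ denote by $\psi^{(\delta)}=(\psi^{(\delta)}_x,\ x\in E)$ a nonnegative infinitely divisible process with no drift and with Lévy measure $\delta\nu$. Then, for any $a\in E$ such that $0<\mathbb{E}[\psi_a]<\infty$, the process $r^{(a)}$ is the limit in law, as $\delta\to0$, of the processes $\psi^{(\delta)}$ under $\mathbb{E}\Big[\dfrac{\psi^{(\delta)}_a}{\mathbb{E}[\psi^{(\delta)}_a]};\ \cdot\ \Big]$.
   Context: $E$ is an arbitrary nonempty set. A process is infinitely divisible if all its finite-dimensional marginals are. For a nonnegative infinitely divisible process $\psi=(\psi_x,x\in E)$ with no drift, its Lévy measure is the unique measure $\nu$ on $\mathbb{R}_+^E$ (all functions $E\to\mathbb{R}_+$, with the cylindrical $\sigma$-algebra) such that for all $n\ge1$, $\alpha_i\ge 0$, $x_i\in E$, $$\mathbb{E}\Big[e^{-\sum_{i=1}^n\alpha_i\psi_{x_i}}\Big]=\exp\Big\{-\int_{\mathbb{R}_+^E}\big(1-e^{-\sum_{i=1}^n\alpha_i y(x_i)}\big)\nu(dy)\Big\},$$ and which has no mass at the zero function $0_E$ in the sense that $\nu(A)=\nu_*(A\setminus\{0_E\})$ for every cylindrical-measurable $A$, where $\nu_*$ is the inner measure. For $a\in E$ with $0<\mathbb{E}[\psi_a]<\infty$, $r^{(a)}=(r^{(a)}(x),x\in E)$ is the nonnegative process (unique in law), independent of $\psi$, such that $\psi+r^{(a)}$ has the law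 of $\psi$ under $\mathbb{E}\big[\frac{\psi_a}{\mathbb{E}[\psi_a]};\ \cdot\ \big]$; equivalently its law is given by $\mathbb{E}[F(r^{(a)})]=\frac{1}{\mathbb{E}[\psi_a]}\int_{\mathbb{R}_+^E}y(a)F(y)\,\nu(dy)$ for measurable $F:\mathbb{R}_+^E\to\mathbb{R}_+$. For a nonnegative random variable $Z$ with $\mathbb{E}Z=1$, ''$\psi$ under $\mathbb{E}[Z;\ \cdot\ ]$'' means the law of $\psi$ under $Z\,d\mathbb{P}$. Convergence in law of processes is convergence of finite-dimensional distributions. *)

(* Defs.v *)
From HB Require Import structures.
From mathcomp Require Import all_boot all_order all_algebra.
From mathcomp Require Import all_classical all_reals all_analysis.

Set Implicit Arguments.
Unset Strict Implicit.
Unset Printing Implicit Defensive.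

Import Order.TTheory GRing.Theory Num.Theory.
Import numFieldNormedType.Exports.

Local Open Scope classical_set_scope.
Local Open Scope ring_scope.

(* {itv R & `[0, +oo[} is what {nonneg R} unfolds to. *)
HB.instance Definition _ (R : numDomainType) :=
  isPointed.Build {itv R & `[0, +oo[} (0%:nng).

Definition cylinders (R : realType) (E : Type) : set (set (E -> {nonneg R})) :=
  [set A | exists x : E, exists2 B : set R,
     measurable B & A = [set y | B (y x)%:num]].

(* All functions E -> R_+ with the cylindrical sigma-algebra. A nonnegative
   process indexed by E is a random element of this space, which amounts to
   measurability of each coordinate. *)
Notation nnpath R E := (g_sigma_algebraType (@cylinders R E)).

Section paths.
Context {R : realType} {E : Type}.

Definition path0 : nnpath R E := fun=> 0%:nng.

Definition path_add (y z : nnpath R E) : nnpath R E :=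
  fun x => ((y x)%:num + (z x)%:num)%:nng.

End paths.

Section infinite_divisibility.
Context {R : realType}.
Local Open Scope ereal_scope.

Definition convolution n (mu rho : set (n.-tuple R) -> \bar R) :
    set (n.-tuple R) -> \bar R :=
  fun A => \int[mu]_u
    rho [set v | A [tuple (tnth u i + tnth v i)%R | i < n]].

Definition convolution_power n (mu : set (n.-tuple R) -> \bar R) (m : nat) :
    set (n.-tuple R) -> \bar R :=
  iter m (convolution mu) \d_([tuple 0%R | _ < n] : n.-tuple R).

Definition infinitely_divisible n (mu : set (n.-tuple R) -> \bar R) : Prop :=
  forall m : nat, (0 < m)%N ->
  exists rho : probability (n.-tuple R) R,
    forall A, measurable A -> mu A = convolution_power rho m A.

Definition infinitely_divisible_process d (Omega : measurableType d)
    (P : probability Omega R) (E : Type) (psi : {RV P >-> nnpath R E}) : Prop :=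
  forall (n : nat) (x : 'I_n -> E),
    infinitely_divisible
      (pushforward P (fun w => [tuple (psi w (x i))%:num | i < n])).

End infinite_divisibility.

Section levy_measure.
Context {R : realType} {E : Type}.
Local Open Scope ereal_scope.

Definition inner_measure (nu : {measure set (nnpath R E) -> \bar R})
    (A : set (nnpath R E)) : \bar R :=
  ereal_sup [set nu B | B in [set B | measurable B /\ B `<=` A]].

(* For uncountable E the singleton [set path0] is not measurable, hence the
   inner measure. *)
Definition no_mass_at_zero (nu : {measure set (nnpath R E) -> \bar R}) : Prop :=
  forall A, measurable A -> nu A = inner_measure nu (A `\` [set path0]).

(* The absence of drift is the absence of a linear term in the exponent. *)
Definition laplace_formula d (Omega : measurableType d)
    (P : probability Omega R) (psi : {RV P >-> nnpath R E})
    (nu : {measure set (nnpath R E) -> \bar R}) : Prop :=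
  forall (n : nat) (alpha : 'I_n -> R) (x : 'I_n -> E),
    (0 < n)%N -> (forall i, (0 <= alpha i)%R) ->
    'E_P[(fun w => expR (- \sum_(i < n) alpha i * (psi w (x i))%:num))] =
    expeR (- \int[nu]_y
      (1 - expR (- \sum_(i < n) alpha i * (y (x i))%:num))%:E).

Definition id_process_without_drift d (Omega : measurableType d)
    (P : probability Omega R) (psi : {RV P >-> nnpath R E})
    (nu : {measure set (nnpath R E) -> \bar R}) : Prop :=
  [/\ infinitely_divisible_process psi,
      laplace_formula psi nu & no_mass_at_zero nu].

End levy_measure.

Section size_bias.
Context {R : realType} {E : Type} d {Omega : measurableType d}
  {P : probability Omega R}.
Implicit Types psi r : {RV P >-> nnpath R E}.
Local Open Scope ereal_scope.

(* E[Z; Y], the expectation of Y under the law Z dP *)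
Definition mean_under (Q : probability Omega R) (Z Y : Omega -> R) : \bar R :=
  'E_Q[(fun w => Z w * Y w)%R].

Definition mean_at psi (a : E) : \bar R := 'E_P[(fun w => (psi w a)%:num)].

Definition size_weight psi (a : E) : Omega -> R :=
  fun w => ((psi w a)%:num / fine (mean_at psi a))%R.

Definition independent_processes psi r : Prop :=
  forall A B : set (nnpath R E), measurable A -> measurable B ->
    P (psi @^-1` A `&` r @^-1` B) = P (psi @^-1` A) * P (r @^-1` B).

(* r is r^(a): independent of psi, and psi + r has the law of psi under
   E[psi_a / E[psi_a]; .] *)
Definition size_bias_increment psi (a : E) r : Prop :=
  independent_processes psi r /\
  forall A : set (nnpath R E), measurable A ->
    P [set w | A (path_add (psi w) (r w))] =
    mean_under P (size_weight psi a) \1_(psi @^-1` A).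

End size_bias.

(* Convergence in law of processes: weak convergence of all finite-dimensional
   distributions. The laws on path space are given by their expectation
   functionals. *)
Definition cvg_in_law (R : realType) (E I : Type) (F : set_system I)
    (law_ : I -> (nnpath R E -> R) -> \bar R)
    (law : (nnpath R E -> R) -> \bar R) : Prop :=
  forall (n : nat) (x : 'I_n -> E) (f : 'rV[R]_n -> R),
    continuous f -> (exists M : R, forall u, `|f u| <= M) ->
    law_ i (fun y => f (\row_(k < n) (y (x k))%:num)) @[i --> F] -->
    law (fun y => f (\row_(k < n) (y (x k))%:num)).

(* Main.v *)
Require Import Defs.
From mathcomp Require Import all_boot all_order all_algebra.
From mathcomp Require Import all_classical all_reals all_analysis.
From mathcomp Require Import measurable_realfun.
From mathcomp Require Import ring lra.

(* Fix a and write J(alpha) for the integral of y(a) exp(-<alpha, y>) against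
   nu, and Phi(alpha) for the Laplace exponent. Differentiating the
   Levy-Khinchine formula in the direction of the coordinate a gives
   E[psi_a exp(-<alpha, psi>)] = exp(-Phi(alpha)) J(alpha). Applied to delta nu
   and normalized by the mean delta J(0), it shows that the size-biased
   psi^(delta) has Laplace transform exp(-delta Phi(alpha)) J(alpha) / J(0);
   applied to psi + r it shows that r has Laplace transform J(alpha) / J(0).
   Convergence of Laplace transforms implies convergence in law: under
   u = exp(-y) the exponentials become monomials, and Bernstein polynomials
   approximate continuous functions of u, the mass escaping to infinity being
   controlled by 1 - exp(-s y_k). *)

Set Implicit Arguments.
Unset Strict Implicit.
Unset Printing Implicit Defensive.

Import Order.TTheory GRing.Theory Num.Theory.
Import numFieldNormedType.Exports.

Local Open Scope classical_set_scope.
Local Open Scope ring_scope.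

(** * Bernstein approximation by exponentials *)

(** Dividing by exp(-Phi) is legitimate because Phi is finite: an infinite value would make the
    Laplace transform of psi vanish, although it integrates a strictly positive function. J is
    finite because J(0) is the mean of psi_a. The measure nu itself may be infinite, and this shapes
    the differentiation: y(a) is not known to be nu-integrable beforehand, so no dominating function
    is at hand under nu. The derivative is therefore one-sided, at 0 and along the steps 2^-k, where
    the difference quotients increase and monotone convergence applies even if the limit is
    infinite. The processes psi^(delta) live on unrelated probability spaces, so laws are compared
    only through integrals, each size-biased law being kept as a density against its own measure.
    Tightness of the family is not proved separately: the error of the exponential approximation is
    bounded by values of Laplace transforms, so its smallness for the limit law passes to small
    delta. *)

Section bernstein.
Context {R : realFieldType}.

(* Pascal's rule replaces the closed form 'C(m, k) X^k (1 - X)^(m - k). *)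
Fixpoint bernstein (m k : nat) : {poly R} :=
  if m is m'.+1 then
    (1 - 'X) * bernstein m' k + (if k is k'.+1 then 'X * bernstein m' k' else 0)
  else (k == 0)%:R.

Lemma bernstein_gt m k : (m < k)%N -> bernstein m k = 0.
Proof.
elim: m k => [|m ih] [|k] //= mk.
by rewrite !ih ?mulr0 ?addr0//; exact: ltnW.
Qed.

Lemma size_bernstein m k : (size (bernstein m k) <= m.+1)%N.
Proof.
elim: m k => [|m ih] k /=; first by case: k => [|k] /=; rewrite ?size_poly1 ?size_poly0.
rewrite (leq_trans (size_polyD _ _))// geq_max; apply/andP; split.
  rewrite (leq_trans (size_polyMleq _ _))// -subn1 leq_subLR.
  apply: (@leq_add _ _ 2 m.+1); last exact: ih.
  rewrite (leq_trans (size_polyD _ _))//.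
  by rewrite size_polyN size_polyX size_poly1.
case: k => [|k]; first by rewrite size_poly0.
rewrite (leq_trans (size_polyMleq _ _))// size_polyX.
by rewrite add2n /=; exact: ih.
Qed.

Lemma bernstein_ge0 m k (u : R) : 0 <= u <= 1 -> 0 <= (bernstein m k).[u].
Proof.
move=> /andP[u0 u1]; elim: m k => [|m ih] k /=.
  by case: k => [|k]; rewrite /= ?hornerE.
rewrite hornerD hornerM !hornerE addr_ge0 ?mulr_ge0 ?subr_ge0//.
by case: k => [|k]; rewrite !hornerE ?mulr_ge0.
Qed.

(** Conditioning a binomial variable on one trial: a failure keeps k, a success raises it by one.
    The total mass and the second moment follow from it by induction on m. *)
Lemma bernstein_rec m (g : nat -> R) (u : R) :
  \sum_(k < m.+2) g k * (bernstein m.+1 k).[u] =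
  (1 - u) * (\sum_(k < m.+1) g k * (bernstein m k).[u]) +
  u * (\sum_(k < m.+1) g k.+1 * (bernstein m k).[u]).
Proof.
have E k : g k * (bernstein m.+1 k).[u] = (1 - u) * (g k * (bernstein m k).[u]) +
    u * (if k is k'.+1 then g k'.+1 * (bernstein m k').[u] else 0).
  by case: k => [|k] /=; rewrite !(hornerD, hornerM, hornerN, hornerX, hornerC, horner0); ring.
rewrite (eq_bigr _ (fun (k : 'I_m.+2) _ => E k)) big_split -!mulr_sumr.
congr (_ * _ + _ * _).
  by rewrite big_ord_recr /= bernstein_gt// horner0 mulr0 addr0.
by rewrite big_ord_recl /= add0r.
Qed.

Lemma bernstein_sum m (u : R) : \sum_(k < m.+1) (bernstein m k).[u] = 1.
Proof.
under eq_bigr do rewrite -[_.[_]]mul1r.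
elim: m => [|m ih]; first by rewrite big_ord1 /= !hornerE.
by rewrite (bernstein_rec m (fun=> 1)) ih; ring.
Qed.

(** Variance plus squared bias. The centre c is arbitrary because the success term of the recursion
    replaces it by c - 1. *)
Lemma bernstein_moment2 m (c u : R) :
  \sum_(k < m.+1) (k%:R - c) ^+ 2 * (bernstein m k).[u] =
  m%:R * u * (1 - u) + (m%:R * u - c) ^+ 2.
Proof.
elim: m c => [|m ih] c; first by rewrite big_ord1 /= hornerC; ring.
rewrite (bernstein_rec m (fun k => (k%:R - c) ^+ 2)) ih.
have E k : k.+1%:R - c = k%:R - (c - 1) by rewrite -natr1; ring.
under eq_bigr do rewrite E.
by rewrite ih -natr1; ring.
Qed.

Lemma bernstein_var m (u : R) : (0 < m)%N -> 0 <= u <= 1 ->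
  \sum_(k < m.+1) (k%:R / m%:R - u) ^+ 2 * (bernstein m k).[u] <= m%:R^-1.
Proof.
move=> m0 /andP[u0 u1].
have m0' : m%:R != 0 :> R by rewrite pnatr_eq0 -lt0n.
rewrite (_ : \sum_(_ < _) _ = m%:R^-1 ^+ 2 *
   \sum_(k < m.+1) (k%:R - m%:R * u) ^+ 2 * (bernstein m k).[u]); last first.
  rewrite mulr_sumr; apply: eq_bigr => k _ /=.
  by rewrite mulrA -exprMn; congr (_ ^+ 2 * _); field.
rewrite bernstein_moment2 subrr expr0n addr0.
rewrite (_ : _ * _ = m%:R^-1 * (u * (1 - u))); last by field.
by rewrite ler_piMr ?invr_ge0// mulr_ile1// ?subr_ge0// gerBl.
Qed.

Variable n : nat.

(** Joint law of n independent binomial variables of m trials each, with success probabilities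
    [u i]. *)
Definition bernstein_weight m (u : 'I_n -> R) (k : {ffun 'I_n -> 'I_m.+1}) :=
  \prod_i (bernstein m (k i)).[u i].

Lemma bernstein_weight_ge0 m (u : 'I_n -> R) k : (forall i, 0 <= u i <= 1) ->
  0 <= bernstein_weight (m := m) u k.
Proof. by move=> u01; apply: prodr_ge0 => i _; exact: bernstein_ge0. Qed.

Lemma bernstein_weight_sum m (u : 'I_n -> R) : \sum_k bernstein_weight (m := m) u k = 1.
Proof.
rewrite /bernstein_weight.
rewrite -(bigA_distr_bigA (fun i (k : 'I_m.+1) => (bernstein m k).[u i])) /=.
by rewrite big1 // => i _; exact: bernstein_sum.
Qed.

Lemma bernstein_weight_var m (u : 'I_n -> R) j : (0 < m)%N -> (forall i, 0 <= u i <= 1) ->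
  \sum_(k : {ffun 'I_n -> 'I_m.+1})
     ((k j)%:R / m%:R - u j) ^+ 2 * bernstein_weight u k <= m%:R^-1.
Proof.
move=> m0 u01.
(* The squared deviation is placed in the factor of coordinate j, so the sum factorizes over
   coordinates and all the other factors sum to 1. *)
pose F i (k : 'I_m.+1) := (if i == j then (k%:R / m%:R - u i) ^+ 2 else 1) *
  (bernstein m k).[u i].
rewrite (_ : \sum_k _ = \sum_(k : {ffun 'I_n -> 'I_m.+1}) \prod_i F i (k i)).
  rewrite -bigA_distr_bigA (bigD1 j)//= [X in _ * X]big1 ?mulr1.
    by rewrite /F eqxx; exact: bernstein_var.
  move=> i /negPf ij; rewrite /F ij.
  by under eq_bigr do rewrite mul1r; exact: bernstein_sum.
apply: eq_bigr => k _; rewrite /F big_split /=; congr (_ * _).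
by rewrite -big_mkcond/= big_pred1_eq.
Qed.

(* Chebyshev's inequality, with [bernstein_weight_var] as variance bound. *)
Lemma bernstein_approx m (g : ('I_n -> R) -> R) (u : 'I_n -> R) (eta eps M : R) :
  (0 < m)%N -> 0 < eta -> 0 <= eps ->
  (forall i, 0 <= u i <= 1) ->
  (forall v, `|g v| <= M) ->
  (forall v, (forall i, 0 <= v i <= 1) -> (forall i, `|v i - u i| < eta) ->
    `|g v - g u| <= eps) ->
  `|g u - \sum_(k : {ffun 'I_n -> 'I_m.+1})
      g (fun i => (k i)%:R / m%:R) * bernstein_weight u k|
  <= eps + 2 * M / eta ^+ 2 * n%:R / m%:R.
Proof.
move=> m0 eta0 eps0 u01 gM gu.
have m0' : 0 < m%:R :> R by rewrite ltr0n.
have M0 : 0 <= M by exact: le_trans (gM u).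
rewrite -[g u]mulr1 -[X in g u * X](bernstein_weight_sum m u) mulr_sumr /=.
rewrite -sumrB; under eq_bigr do rewrite -mulrBl.
pose S (k : {ffun 'I_n -> 'I_m.+1}) := \sum_i ((k i)%:R / m%:R - u i) ^+ 2.
have H (k : {ffun 'I_n -> 'I_m.+1}) :
    `|g u - g (fun i => (k i)%:R / m%:R)| <= eps + 2 * M / eta ^+ 2 * S k.
  have S0 : 0 <= S k by apply: sumr_ge0 => i _; exact: sqr_ge0.
  have [/forallP near|/forallPn[j]] :=
      boolP [forall i, `|(k i)%:R / m%:R - u i| < eta].
    rewrite distrC (le_trans (gu _ _ near))//.
      move=> i; rewrite divr_ge0//= ler_pdivrMr// mul1r ler_nat.
      by rewrite -ltnS.
    by rewrite lerDl mulr_ge0// divr_ge0 ?sqr_ge0// mulr_ge0.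
  rewrite -leNgt => far.
  rewrite (le_trans (ler_normB _ _))// (le_trans (lerD (gM _) (gM _)))//.
  rewrite (_ : M + M = 2 * M); last by ring.
  rewrite (@le_trans _ _ (2 * M / eta ^+ 2 * S k)) ?lerDr//.
  rewrite -mulrA ler_peMr// ?mulr_ge0//.
  rewrite ler_pdivlMl ?exprn_gt0// mulr1.
  rewrite /S (bigD1 j)//= ler_wpDr//.
    by apply: sumr_ge0 => i _; exact: sqr_ge0.
  by rewrite -[leRHS]real_normK ?num_real// lerXn2r// nnegrE ?ltW.
rewrite (le_trans (ler_norm_sum _ _ _))//.
rewrite (@le_trans _ _ (\sum_(k : {ffun 'I_n -> 'I_m.+1})
    (eps + 2 * M / eta ^+ 2 * S k) * bernstein_weight u k))//.
  apply: ler_sum => k _; rewrite normrM [X in _ * X]ger0_norm.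
    by rewrite ler_wpM2r// bernstein_weight_ge0.
  exact: bernstein_weight_ge0.
under eq_bigr do rewrite mulrDl -mulrA.
rewrite big_split /= -!mulr_sumr /= bernstein_weight_sum mulr1 lerD2l.
rewrite -[leRHS]mulrA ler_wpM2l//.
  by rewrite divr_ge0 ?sqr_ge0// mulr_ge0.
under eq_bigr do rewrite /S mulr_suml /=.
rewrite exchange_big/= (@le_trans _ _ (\sum_(i < n) m%:R^-1))//.
  by apply: ler_sum => i _; exact: bernstein_weight_var.
by rewrite sumr_const card_ord mulr_natl.
Qed.

End bernstein.

(** * Approximation of bounded continuous functions on the orthant by sums of exponentials *)

Section exponential_approximation.
Context {R : realType} (n : nat).
Implicit Types (f : 'rV[R]_n -> R) (y : 'I_n -> R).

(** Compactness of the box, in its near-covering form, merges the local radii of continuity into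
    one. Only u has to lie in the box. *)
Lemma continuous_unif_box f (K eps : R) : continuous f -> 0 < eps ->
  exists2 eta, 0 < eta & forall u v : 'I_n -> R,
    (forall i, 0 <= u i <= K) -> (forall i, `|v i - u i| < eta) ->
    `|f (\row_i v i) - f (\row_i u i)| <= eps.
Proof.
move=> cf eps0.
pose box := [set w : 'rV[R]_n | forall i, [set` `[0, K]] (w ord0 i)].
have : compact box.
  by apply: (@rV_compact R n (fun=> [set` `[0, K]])) => i; exact: segment_compact.
move=> /compact_near_coveringP /(_ _ (0^'+ : set_system R)
  (fun e w => forall v : 'rV[R]_n, (forall i, `|v ord0 i - w ord0 i| < e) ->
    `|f v - f w| <= eps) _).
have eps2 : 0 < eps / 2 by rewrite divr_gt0.
case.
  move=> x _; have /cvgrPdist_lt /(_ _ eps2) := cf x.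
  move=> /nbhs_ballP[e /= e0 He].
  have e2 : 0 < e / 2 by rewrite divr_gt0.
  (* Halved radii: w within e/2 of x and v within e/2 of w put both points in the ball of radius e
     about x. *)
  exists (ball x (e / 2), [set t | t < e / 2]) => /=.
    split; first exact: nbhsx_ballx.
    exact: nbhs_right_lt.
  move=> [w t] /= [[_ xw] te] v vw.
  rewrite (_ : f v - f w = (f x - f w) - (f x - f v)); last by ring.
  rewrite (le_trans (ler_normB _ _))// [leRHS]splitr lerD// ltW//; apply: He.
    by split=> // i j; apply: lt_trans (xw i j) _; rewrite ltr_pdivrMr// ltr_pMr// ltr1n.
  split=> // i j; rewrite ord1 -ball_normE /=.
  rewrite (_ : _ - _ = (x ord0 j - w ord0 j) - (v ord0 j - w ord0 j)); last by ring.
  rewrite (le_lt_trans (ler_normB _ _))// [ltRHS]splitr ltrD//.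
    by have := xw ord0 j; rewrite -ball_normE.
  exact: lt_trans te.
move=> eta /= eta0 H.
exists (eta / 2); first by rewrite divr_gt0.
move=> u v uK vu; apply: (H (eta / 2)) => //.
- rewrite /= sub0r normrN gtr0_norm ?divr_gt0// ltr_pdivrMr// ltr_pMr//.
  by rewrite ltr1n.
- by rewrite divr_gt0.
- by move=> i /=; rewrite mxE in_itv/=.
- by move=> i; rewrite !mxE.
Qed.

Lemma ln_lipschitz (c x y : R) : 0 < c -> c <= x -> c <= y ->
  `|ln x - ln y| <= `|x - y| / c.
Proof.
move=> c0; wlog : x y / y <= x => [H cx cy|yx cx cy].
  have [yx|/ltW xy] := leP y x; first exact: H.
  by rewrite distrC [`|x - y|]distrC; exact: H.
have x0 := lt_le_trans c0 cx; have y0 := lt_le_trans c0 cy.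
rewrite !ger0_norm ?subr_ge0 ?ler_ln// -ln_div//.
have -> : x / y = 1 + (x - y) / y by field; rewrite gt_eqF.
rewrite (@le_trans _ _ ((x - y) / y))//.
  by rewrite le_ln1Dx// (@lt_le_trans _ _ 0)// divr_ge0 ?subr_ge0// ltW.
by rewrite ler_wpM2l ?subr_ge0// lef_pV2.
Qed.

Lemma normr_max_le (c x y : R) : `|Num.max x c - Num.max y c| <= `|x - y|.
Proof.
have H a b : Num.max a c - Num.max b c <= `|a - b|.
  rewrite lerBlDr ge_max; apply/andP; split.
    rewrite -[leLHS](subrK b) lerD ?ler_norm//.
    by rewrite le_max lexx.
  by rewrite ler_wpDl// le_max lexx orbT.
by rewrite ler_norml H andbT lerNl opprB distrC H.
Qed.

Lemma bernstein_weight_expR m (k : {ffun 'I_n -> 'I_m.+1}) :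
  exists c : {ffun 'I_n -> 'I_m.+1} -> R, forall y,
    bernstein_weight (fun i => expR (- y i)) k =
    \sum_(e : {ffun 'I_n -> 'I_m.+1}) c e * expR (- \sum_i (e i)%:R * y i).
Proof.
exists (fun e : {ffun 'I_n -> 'I_m.+1} => \prod_i (bernstein m (k i))`_(e i)) => y.
rewrite /bernstein_weight.
under eq_bigr do rewrite (horner_coef_wide _ (size_bernstein _ _)).
rewrite bigA_distr_bigA /=; apply: eq_bigr => e _.
rewrite big_split /=; congr (_ * _).
rewrite -sumrN expR_sum; apply: eq_bigr => i _.
by rewrite -mulrN expRM_natl.
Qed.

(* The right-hand side is uniform in y: the tail term is itself controlled by
   Laplace transforms. *)
Lemma exponential_approx f (M eps s : R) :
  continuous f -> (forall u, `|f u| <= M) -> 0 < eps -> 0 < s ->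
  exists m (c : {ffun 'I_n -> 'I_m.+1} -> R), forall y,
    (forall i, 0 <= y i) ->
    `|f (\row_i y i) - \sum_(e : {ffun 'I_n -> 'I_m.+1})
        c e * expR (- \sum_i (e i)%:R * y i)|
    <= eps + 4 * M * \sum_i (1 - expR (- (s * y i))).
Proof.
move=> cf fM eps0 s0.
have M0 : 0 <= M by exact: le_trans (fM 0).
have eps2 : 0 < eps / 2 by rewrite divr_gt0.
(* Truncation level tied to s: as soon as [y j] exceeds K, [s * y j] exceeds 1 and the j-th tail
   term is at least 1/2. *)
pose K := s^-1.
have [eta eta0 Heta] := continuous_unif_box K cf eps2.
pose c0 := expR (- K).
have c00 : 0 < c0 by exact: expR_gt0.
(* Inverse of u = exp(-t), capped at K: it maps exp(-t) to min(t, K). The cap removes the blow-up of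
   -ln at u = 0, so g is continuous on the whole cube. *)
pose phi (u : R) := - ln (Num.max u c0).
pose g (u : 'I_n -> R) := f (\row_i phi (u i)).
have phiE t : phi (expR (- t)) = Num.min t K.
  rewrite /phi /c0; have [tK|Kt] := leP t K.
    by rewrite max_l ?expRK ?opprK// ler_expR lerN2.
  by rewrite max_r ?expRK ?opprK// ler_expR lerN2 ltW.
have phi01 u : 0 <= u <= 1 -> 0 <= phi u <= K.
  move=> /andP[u0 u1]; rewrite /phi oppr_ge0 lerNl.
  apply/andP; split.
    apply: ln_le0; rewrite ge_max u1 /c0 -expR0 ler_expR lerNl oppr0.
    by rewrite invr_ge0 ltW.
  rewrite -[leLHS]expRK ler_ln ?posrE ?expR_gt0 ?le_max ?lexx ?orbT//.
  by rewrite lt_max c00 orbT.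
(* The factor c0 compensates the Lipschitz constant 1/c0 of ln beyond c0; A / m is then the second
   error term of [bernstein_approx], and m is chosen to bring it below eps / 2. *)
pose eta' := eta * c0.
have eta'0 : 0 < eta' by rewrite mulr_gt0.
pose A := 2 * M / eta' ^+ 2 * n%:R.
have A0 : 0 <= A.
  by rewrite mulr_ge0// divr_ge0 ?sqr_ge0// mulr_ge0.
pose m := (Num.truncn (A / (eps / 2))).+1.
have mA : A / m%:R <= eps / 2.
  rewrite ler_pdivrMr ?ltr0n// mulrC -ler_pdivrMr// ltW// truncnS_gt//.
have [c Hc] := choice (@bernstein_weight_expR m).
exists m, (fun e => \sum_(k : {ffun 'I_n -> 'I_m.+1})
  g (fun i => (k i)%:R / m%:R) * c k e) => y y0.
pose u i := expR (- y i).
have u01 i : 0 <= u i <= 1.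
  by rewrite /u expR_ge0 /= -[leRHS]expR0 ler_expR lerNl oppr0.
have -> : \sum_(e : {ffun 'I_n -> 'I_m.+1})
    (\sum_(k : {ffun 'I_n -> 'I_m.+1}) g (fun i => (k i)%:R / m%:R) * c k e) *
    expR (- (\sum_i (e i)%:R * y i)) =
    \sum_(k : {ffun 'I_n -> 'I_m.+1})
      g (fun i => (k i)%:R / m%:R) * bernstein_weight u k.
  under [RHS]eq_bigr do rewrite Hc mulr_sumr.
  rewrite [RHS]exchange_big; apply: eq_bigr => e _.
  by rewrite mulr_suml; apply: eq_bigr => k _; rewrite mulrA.
have gB : `|g u - \sum_(k : {ffun 'I_n -> 'I_m.+1})
      g (fun i => (k i)%:R / m%:R) * bernstein_weight u k| <= eps.
  rewrite (le_trans (bernstein_approx (m := m) (eta := eta') (eps := eps / 2)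
    (M := M) _ _ _ _ _ _))//.
  - exact: ltW.
  - by move=> v; exact: fM.
  - move=> v v01 vu; apply: Heta => i; first exact: phi01.
    rewrite /phi opprK addrC (le_lt_trans (ln_lipschitz (c := c0) _ _ _))//.
    + by rewrite le_max lexx orbT.
    + by rewrite le_max lexx orbT.
    rewrite ltr_pdivrMr// (le_lt_trans _ (vu i))//.
    by rewrite distrC; exact: normr_max_le.
  - by rewrite [leRHS]splitr lerD2l.
have tail_ge0 i : 0 <= 1 - expR (- (s * y i)).
  by rewrite subr_ge0 -[leRHS]expR0 ler_expR lerNl oppr0 mulr_ge0// ltW.
have fg : `|f (\row_i y i) - g u| <= 4 * M * \sum_i (1 - expR (- (s * y i))).
  have [/forallP yK|/forallPn[j]] := boolP [forall i, y i <= K].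
    have -> : g u = f (\row_i y i).
      congr f; apply/rowP => i; rewrite !mxE phiE.
      by apply/min_idPl; exact: yK.
    rewrite subrr normr0 mulr_ge0// ?mulr_ge0//.
    exact: sumr_ge0.
  rewrite -ltNge => Ky.
  rewrite (le_trans (ler_normB _ _))// (le_trans (lerD (fM _) (fM _)))//.
  (* Origin of the constant 4: beyond the box the two values differ by at most 2M, while the tail
     sum is at least 1/2, since exp(-1) is at most 1/2. *)
  rewrite (_ : M + M = 4 * M * 2^-1); last by field.
  rewrite ler_wpM2l ?mulr_ge0// (bigD1 j)//= ler_wpDr//.
    exact: sumr_ge0.
  rewrite lerBrDl -lerBrDr (_ : 1 - 2^-1 = 2^-1); last by field.
  rewrite (@le_trans _ _ (expR (- 1)))//.
    rewrite ler_expR lerN2 -(@mulfV _ s) ?gt_eqF//.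
    by rewrite ler_pM2l// ltW.
  rewrite expRN lef_pV2 ?posrE ?expR_gt0//.
  by rewrite (le_trans _ (expR_ge1Dx 1)).
rewrite (_ : f _ - _ = (f (\row_i y i) - g u) + (g u - \sum_(k : {ffun 'I_n -> 'I_m.+1})
      g (fun i => (k i)%:R / m%:R) * bernstein_weight u k)); last by ring.
by rewrite (le_trans (ler_normD _ _))// addrC lerD.
Qed.

End exponential_approximation.

(** * Differentiating the Levy-Khinchine formula *)

Section secant.
Context {R : realType}.
Implicit Types (x : R) (k : nat).

Lemma expRN_le1 x : 0 <= x -> expR (- x) <= 1.
Proof. by move=> x0; rewrite -[leRHS]expR0 ler_expR oppr_le0. Qed.

Lemma subr1_expRN_le x : 1 - expR (- x) <= x.
Proof. by rewrite lerBlDl -lerBlDr; exact: expR_ge1Dx. Qed.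

Lemma subr1_expRN_ge x : x * expR (- x) <= 1 - expR (- x).
Proof.
rewrite lerBrDl -{1}[expR (- x)]mul1r -mulrDl.
rewrite -[leRHS](expRxMexpNx_1 x) ler_wpM2r ?expR_ge0//.
exact: expR_ge1Dx.
Qed.

(* The slope at 0 of t |-> 1 - exp(- t x), along t = 2^-k; dyadic steps make
   it monotone in k. *)
Definition secant k x := 2 ^+ k * (1 - expR (- (x / 2 ^+ k))).

Lemma secant_ge0 k x : 0 <= x -> 0 <= secant k x.
Proof.
by move=> x0; rewrite mulr_ge0 ?exprn_ge0// subr_ge0 expRN_le1// divr_ge0// exprn_ge0.
Qed.

(** With q the exponential at the halved step, the two slopes are p (1 - q)(1 + q) and 2 p (1 - q),
    and 1 + q is at most 2. *)
Lemma nondecreasing_secant x : 0 <= x -> nondecreasing_seq (secant ^~ x).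
Proof.
move=> x0; apply/nondecreasing_seqP => k; rewrite /secant exprS.
set p := 2 ^+ k; have p0 : 0 < p by rewrite exprn_gt0.
set q := expR (- (x / (2 * p))).
have -> : expR (- (x / p)) = q ^+ 2.
  by rewrite -expRM_natl; congr expR; field; rewrite gt_eqF.
have q1 : q <= 1 by rewrite expRN_le1// divr_ge0// mulr_ge0// ltW.
rewrite (_ : 1 - q ^+ 2 = (1 - q) * (1 + q)); last by ring.
rewrite [2 * p]mulrC -mulrA ler_pM2l// mulrC ler_wpM2r ?subr_ge0//.
by rewrite -[leRHS]/(1 + 1) lerD2l.
Qed.

Lemma secant_bounds k x : x * expR (- (x / 2 ^+ k)) <= secant k x <= x.
Proof.
rewrite /secant; set p := 2 ^+ k; have p0 : 0 < p by rewrite exprn_gt0.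
have E : x = p * (x / p) by field; rewrite gt_eqF.
apply/andP; split; last by rewrite [leRHS]E ler_pM2l// subr1_expRN_le.
by rewrite {1}E -mulrA ler_pM2l// subr1_expRN_ge.
Qed.

Lemma cvg_div_exp2 x : x / 2 ^+ k @[k --> \oo] --> (0 : R).
Proof.
have H : (2^-1 : R) ^+ k @[k --> \oo] --> (0 : R).
  by apply: cvg_expr; rewrite ger0_norm// invf_lt1// ltr1n.
rewrite -(mulr0 x); under eq_fun do rewrite -exprVn.
exact: cvgMl_tmp H.
Qed.

Lemma cvg_expRN_div_exp2 x : expR (- (x / 2 ^+ k)) @[k --> \oo] --> (1 : R).
Proof.
have := cvg_comp _ _ (cvgN (cvg_div_exp2 x)) (@continuous_expR R (- 0)).
rewrite oppr0 expR0 => H; exact: H.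
Qed.

Lemma cvg_secant x : secant k x @[k --> \oo] --> x.
Proof.
apply: (@squeeze_cvgr _ _ _ _ (fun k => x * expR (- (x / 2 ^+ k))) (fun=> x)).
- by near=> k; exact: secant_bounds.
- rewrite -[X in _ --> X](mulr1 x); apply: cvgMl_tmp; exact: cvg_expRN_div_exp2.
- exact: cvg_cst.
Unshelve. all: by end_near. Qed.

Lemma measurable_secant k : measurable_fun setT (secant k).
Proof.
apply: measurable_funM => //; apply: measurable_funB => //.
apply: measurableT_comp => //; apply: measurableT_comp => //.
by apply: measurable_funM.
Qed.

End secant.

(** * Passage to the limit in the dyadic difference quotients *)

Section levy_khinchine.
Local Open Scope ereal_scope.

(** A zero integral would make a strictly positive function vanish almost everywhere, against total
    mass 1. This is what rules out an infinite Laplace exponent. *)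
Lemma integral_expRN_gt0 d (T : measurableType d) (R : realType)
    (P : probability T R) (Y : T -> R) : measurable_fun setT Y ->
  0 < \int[P]_w (expR (- Y w))%:E.
Proof.
move=> mY; rewrite lt0e; apply/andP; split; last first.
  by apply: integral_ge0 => w _; rewrite lee_fin expR_ge0.
apply/negP => /eqP int0.
have mE : measurable_fun setT (fun w => (expR (- Y w))%:E).
  apply/measurable_EFinP; apply: measurableT_comp => //; exact: measurableT_comp.
have := ae_eq_integral_abs P measurableT mE.
under eq_integral do rewrite gee0_abs ?lee_fin ?expR_ge0//.
move=> [+ _] => /(_ int0) [N [mN N0 sub]].
have : setT `<=` N.
  move=> w _; apply: sub => /= /(_ Logic.I) /eqP.
  by rewrite eqe gt_eqF// expR_gt0.
rewrite subTset => NT; have : P setT = 0 by rewrite -NT.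
by rewrite probability_setT => /eqP; rewrite onee_eq0.
Qed.

(** Monotone convergence: neither a finite measure nor a finite limit is required, so the same
    statement serves for P and for the Levy measure. *)
Lemma ge0_cvg_monotone_secant d (T : measurableType d) (R : realType)
    (mu : {measure set T -> \bar R}) (X Y : T -> R) :
  measurable_fun setT X -> measurable_fun setT Y -> (forall w, 0 <= X w)%R ->
  \int[mu]_w (secant k (X w) * expR (- Y w))%:E @[k --> \oo] -->
  \int[mu]_w (X w * expR (- Y w))%:E.
Proof.
move=> mX mY X0.
have mE : measurable_fun setT (fun w => expR (- Y w)).
  by apply: measurableT_comp => //; exact: measurableT_comp.
have H w : (secant k (X w) * expR (- Y w))%:E @[k --> \oo] -->
    (X w * expR (- Y w))%:E.
  by apply: cvg_EFin; [exact: nearW|apply: cvgMr_tmp; exact: cvg_secant].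
under [X in _ --> X]eq_integral => w _ do rewrite -(cvg_lim _ (H w))//.
apply: cvg_monotone_convergence => //.
- move=> k; apply/measurable_EFinP; apply: measurable_funM => //.
  by apply: measurableT_comp => //; exact: measurable_secant.
- by move=> k w _; rewrite lee_fin mulr_ge0 ?secant_ge0// expR_ge0.
- move=> w _ m k mk; rewrite lee_fin ler_wpM2r ?expR_ge0//.
  exact: nondecreasing_secant.
Qed.

(* The conclusion is the right derivative of the hypothesis at [t = 0]. *)
Lemma derive_levy_khinchine (R : realType)
    d1 (T1 : measurableType d1) (P : probability T1 R) (X Y : T1 -> R)
    d2 (T2 : measurableType d2) (nu : {measure set T2 -> \bar R}) (f g : T2 -> R) :
  measurable_fun setT X -> measurable_fun setT Y ->
  (forall w, 0 <= X w)%R -> (forall w, 0 <= Y w)%R ->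
  measurable_fun setT f -> measurable_fun setT g ->
  (forall y, 0 <= f y)%R -> (forall y, 0 <= g y)%R ->
  (forall t : R, (0 <= t)%R ->
    \int[P]_w (expR (- (t * X w + Y w)))%:E =
    expeR (- \int[nu]_y (1 - expR (- (t * f y + g y)))%:E)) ->
  \int[P]_w (X w * expR (- Y w))%:E =
  \int[P]_w (expR (- Y w))%:E * \int[nu]_y (f y * expR (- g y))%:E.
Proof.
move=> mX mY X0 Y0 mf mg f0 g0 LK.
have mexp d (T : measurableType d) (h : T -> R) : measurable_fun setT h ->
    measurable_fun setT (fun w => (expR (- h w))%:E).
  move=> mh; apply/measurable_EFinP.
  by apply: measurableT_comp => //; exact: measurableT_comp.
have mlin t : measurable_fun setT (fun w => t * X w + Y w)%R.
  by apply: measurable_funD => //; exact: measurable_funM.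
pose p k : R := (2 ^- k)%R.
have p0 k : (0 < p k)%R by rewrite invr_gt0 exprn_gt0.
pose Lt t := \int[P]_w (expR (- (t * X w + Y w)))%:E.
have Lt_fin t : (0 <= t)%R -> Lt t \is a fin_num.
  move=> t0; rewrite ge0_fin_numE; last first.
    by apply: integral_ge0 => w _; rewrite lee_fin expR_ge0.
  rewrite (@le_lt_trans _ _ (\int[P]_w cst 1 w))//.
    apply: ge0_le_integral => //.
    - exact: (mexp _ _ _ (mlin t)).
    - by move=> w _; rewrite lee_fin expRN_le1// addr_ge0// mulr_ge0.
  by rewrite integral_cst// mul1e (le_lt_trans (@probability_le1 _ _ _ P _ _))// ltry.
have LtE t : (0 <= t)%R -> Lt t = (fine (Lt t))%:E.
  by move=> t0; rewrite fineK// Lt_fin.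
pose Phi t := \int[nu]_y (1 - expR (- (t * f y + g y)))%:E.
have Phi_ge0 t : (0 <= t)%R -> 0 <= Phi t.
  move=> t0; apply: integral_ge0 => y _; rewrite lee_fin subr_ge0 expRN_le1//.
  by rewrite addr_ge0// mulr_ge0.
have Phi_fin t : (0 <= t)%R -> Phi t \is a fin_num.
  move=> t0; rewrite ge0_fin_numE ?Phi_ge0// ltey; apply/eqP => Phioo.
  have := integral_expRN_gt0 P (mlin t).
  by rewrite LK// -/(Phi t) Phioo /= ltxx.
pose D k := \int[nu]_y ((1 - expR (- (f y / 2 ^+ k))) * expR (- g y))%:E.
have Dint_ge0 k y : (0 <= (1 - expR (- (f y / 2 ^+ k))) * expR (- g y))%R.
  by rewrite mulr_ge0 ?expR_ge0// subr_ge0 expRN_le1// divr_ge0// exprn_ge0.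
have D_ge0 k : 0 <= D k by apply: integral_ge0 => y _; rewrite lee_fin.
have mD k : measurable_fun setT (fun y =>
    ((1 - expR (- (f y / 2 ^+ k))) * expR (- g y))%:E).
  apply/measurable_EFinP; apply: measurable_funM; last exact/measurable_EFinP/mexp.
  apply: measurable_funB => //.
  by apply/measurable_EFinP/mexp; exact: measurable_funM.
(* The increment of the exponent is a nonnegative integral, so additivity needs no integrability;
   finiteness of [D k] is then read off from that of [Phi (p k)]. *)
have PhiD k : Phi (p k) = Phi 0%R + D k.
  rewrite /Phi /D -ge0_integralD//.
  - by apply: eq_integral => y _; rewrite -EFinD mul0r add0r opprD expRD
      [(p k * _)%R]mulrC /p; congr EFin; ring.
  - by move=> y _; rewrite lee_fin mul0r add0r subr_ge0 expRN_le1.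
  - apply/measurable_EFinP/measurable_funB => //.
    by apply/measurable_EFinP/mexp; apply: measurable_funD => //; exact: measurable_funM.
  - by move=> y _; rewrite lee_fin.
have D_fin k : D k \is a fin_num.
  have := Phi_fin (p k) (ltW (p0 k)); rewrite PhiD fin_numD.
  by case/andP.
pose L := fine (Lt 0%R).
pose Dk k := fine (D k).
pose Lk k := fine (Lt (p k)).
have DkE k : D k = (Dk k)%:E by rewrite fineK.
have LkE k : Lk k = (L * expR (- Dk k))%R.
  rewrite /Lk /L /Lt !LK// ?ltW// -/(Phi _) -/(Phi _) PhiD.
  rewrite -[Phi 0%R]fineK ?Phi_fin// DkE /=.
  by rewrite opprD expRD.
have L0E : \int[P]_w (expR (- Y w))%:E = L%:E.
  rewrite -LtE//; apply: eq_integral => w _.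
  by rewrite mul0r add0r.
have Lge0 : (0 <= L)%R.
  by rewrite -lee_fin -L0E; apply: integral_ge0 => w _; rewrite lee_fin expR_ge0.
have cvgX := ge0_cvg_monotone_secant (mu := P) mX mY X0.
have cvgf := ge0_cvg_monotone_secant (mu := nu) mf mg f0.
have EX k : \int[P]_w (secant k (X w) * expR (- Y w))%:E =
    (2 ^+ k * (L - Lk k))%:E.
  pose B := \int[P]_w ((1 - expR (- (X w / 2 ^+ k))) * expR (- Y w))%:E.
  have mB : measurable_fun setT (fun w =>
      ((1 - expR (- (X w / 2 ^+ k))) * expR (- Y w))%:E).
    apply/measurable_EFinP; apply: measurable_funM; last exact/measurable_EFinP/mexp.
    apply: measurable_funB => //.
    by apply/measurable_EFinP/mexp; exact: measurable_funM.
  have Bint_ge0 w : (0 <= (1 - expR (- (X w / 2 ^+ k))) * expR (- Y w))%R.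
    by rewrite mulr_ge0 ?expR_ge0// subr_ge0 expRN_le1// divr_ge0// exprn_ge0.
  have LB : L%:E = (Lk k)%:E + B.
    rewrite -L0E /Lk -LtE ?ltW// /Lt /B -ge0_integralD//.
    - apply: eq_integral => w _; rewrite -EFinD opprD expRD [(p k * _)%R]mulrC.
      by congr EFin; rewrite /p; ring.
    - exact: (mexp _ _ _ (mlin _)).
    - by move=> w _; rewrite lee_fin.
  rewrite EFinM EFinB LB [_ + B]addeC addeK// /B -ge0_integralZl_EFin ?exprn_ge0//.
  - by apply: eq_integral => w _; rewrite -EFinM /secant mulrA.
  - by move=> w _; rewrite lee_fin.
have Ef k : \int[nu]_y (secant k (f y) * expR (- g y))%:E = (2 ^+ k * Dk k)%:E.
  rewrite EFinM -DkE /D -ge0_integralZl_EFin ?exprn_ge0//.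
  - by apply: eq_integral => y _; rewrite -EFinM /secant mulrA.
  - by move=> y _; rewrite lee_fin.
rewrite L0E.
(* Continuity of the transform at 0, dominated by 1: it makes the lower bound of the squeeze below
   have the same limit as the upper one. *)
have Lk_cvg : Lk k @[k --> \oo] --> L.
  have mLt t : measurable_fun setT (fun w => (expR (- (t * X w + Y w)))%:E).
    exact: (mexp _ _ _ (mlin t)).
  have [] := @dominated_convergence _ _ _ P setT measurableT
    (fun k w => (expR (- (p k * X w + Y w)))%:E) (fun w => (expR (- Y w))%:E)
    (cst 1) (fun k => mLt (p k)) (mexp _ _ _ mY).
  - apply: aeW => w _; apply/fine_cvgP; split; first exact: nearW.
    rewrite -[X in _ --> X]mul1r.
    rewrite (_ : fine \o _ = (fun k => expR (- (X w / 2 ^+ k)) * expR (- Y w))%R).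
      by apply: cvgMr_tmp; exact: cvg_expRN_div_exp2.
    by apply/funext => k /=; rewrite opprD expRD [(p k * _)%R]mulrC.
  - exact: finite_measure_integrable_cst.
  - apply: aeW => w k _; rewrite /= lee_fin ger0_norm ?expR_ge0//.
    by rewrite expRN_le1// addr_ge0// mulr_ge0// ltW.
  move=> _ _; rewrite L0E => H.
  exact: (fine_cvg H).
apply: (cvg_unique _ cvgX).
  exact: ereal_hausdorff.
(* The quotient for X equals 2^k L (1 - exp(-Dk)); the bounds x exp(-x) <= 1 - exp(-x) <= x at x =
   Dk enclose it between Lk and L times the quotient for f. *)
apply: (@squeeze_cvge _ _ _ _ (fun k => (Lk k)%:E * (2 ^+ k * Dk k)%:E) _
   (fun k => L%:E * (2 ^+ k * Dk k)%:E)).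
- apply: nearW => k; rewrite EX -!EFinM !lee_fin LkE.
  rewrite (_ : L - L * _ = L * (1 - expR (- Dk k)))%R; last by ring.
  apply/andP; split.
    rewrite mulrCA ler_pM2l ?exprn_gt0// -mulrA ler_wpM2l//.
    by rewrite mulrC subr1_expRN_ge.
  by rewrite mulrCA ler_wpM2l// ler_pM2l ?exprn_gt0// subr1_expRN_le.
- apply: cvgeM.
  (* The integral against nu may be infinite here, so the limit product is well defined because L is
     nonzero. *)
  + rewrite mule_defE /= andbF orbF negb_and eqe gt_eqF//.
    by rewrite -lte_fin -L0E integral_expRN_gt0.
  + by apply/fine_cvgP; split; [exact: nearW|exact: Lk_cvg].
  + by under eq_fun do rewrite -Ef.
- by apply: cvgeZl => //; under eq_fun do rewrite -Ef.
Qed.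

End levy_khinchine.

(** * Continuity theorem for Laplace transforms *)

Lemma cvg_sumr (R : realType) (I J : Type) (F : set_system I) (r : seq J)
    (u : J -> I -> R) (l : J -> R) : Filter F ->
  (forall j, u j i @[i --> F] --> l j) ->
  \sum_(j <- r) u j i @[i --> F] --> \sum_(j <- r) l j.
Proof.
by move=> FF ul; apply: cvg_big => //; exact: add_continuous.
Qed.

Section weighted_mean.
Context {R : realType} d {T : measurableType d}.
Variables (mu : {measure set T -> \bar R}) (Z : T -> R).
Implicit Types g h : T -> R.

(** The law Z dmu is kept as a measure and a density. Density 1 gives plain expectations, so r and
    the size-biased processes share the same lemmas. *)
Definition weighted_mean h := \int[mu]_w (Z w * h w).

Definition probability_weight :=
  [/\ mu.-integrable setT (EFin \o Z), (forall w, 0 <= Z w) &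
      \int[mu]_w Z w = 1].

Hypothesis hZ : probability_weight.

Let mZ : measurable_fun setT Z.
Proof. by case: hZ => /integrableP[/measurable_EFinP]. Qed.

Lemma integrable_weight (h : T -> R) (M : R) : measurable_fun setT h ->
  (forall w, `|h w| <= M) -> mu.-integrable setT (EFin \o (fun w => Z w * h w)).
Proof.
move=> mh hM; have [iZ Z0 _] := hZ.
apply: (@le_integrable _ _ _ _ _ _ _ (fun w => M%:E * (EFin \o Z) w)%E) => //.
- by apply/measurable_EFinP; exact: measurable_funM.
- move=> w _; rewrite -EFinM !abse_EFin lee_fin !normrM.
  by rewrite mulrC ler_wpM2r// (le_trans (hM w))// ler_norm.
- exact: integrableZl.
Qed.

Lemma weighted_mean1 : weighted_mean (fun=> 1) = 1.
Proof.
by rewrite /weighted_mean; under eq_Rintegral do rewrite mulr1; case: hZ.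
Qed.

Lemma weighted_meanB g h M N :
  measurable_fun setT g -> measurable_fun setT h ->
  (forall w, `|g w| <= M) -> (forall w, `|h w| <= N) ->
  weighted_mean (fun w => g w - h w) = weighted_mean g - weighted_mean h.
Proof.
move=> mg mh gM hM; rewrite /weighted_mean -RintegralB//.
- by apply: eq_Rintegral => w _; rewrite mulrBr.
- exact: integrable_weight gM.
- exact: integrable_weight hM.
Qed.

Lemma weighted_meanZ c h M : measurable_fun setT h -> (forall w, `|h w| <= M) ->
  weighted_mean (fun w => c * h w) = c * weighted_mean h.
Proof.
move=> mh hM; rewrite /weighted_mean -RintegralZl//.
  by apply: eq_Rintegral => w _; rewrite mulrCA.
exact: integrable_weight hM.
Qed.

Lemma weighted_mean_cst c : weighted_mean (fun=> c) = c.
Proof.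
rewrite -[RHS]mulr1 -weighted_mean1 -(@weighted_meanZ c (fun=> 1) 1)//.
  by congr weighted_mean; apply/funext => w; rewrite mulr1.
by move=> w; rewrite normr1.
Qed.

Lemma weighted_mean_sum (I : Type) (s : seq I) (c : I -> R) (h : I -> T -> R) M :
  (forall i, measurable_fun setT (h i)) -> (forall i w, `|h i w| <= M) ->
  weighted_mean (fun w => \sum_(i <- s) c i * h i w) =
  \sum_(i <- s) c i * weighted_mean (h i).
Proof.
move=> mh hM.
have H i : mu.-integrable setT (EFin \o (fun w => Z w * (c i * h i w))).
  apply: (@integrable_weight _ (`|c i| * M)); first exact: measurable_funM.
  by move=> w; rewrite normrM ler_wpM2l.
elim: s => [|i s ih].
  rewrite big_nil /weighted_mean; under eq_Rintegral do rewrite big_nil mulr0.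
  by rewrite Rintegral_cst// mul0r.
rewrite big_cons -ih -(weighted_meanZ _ (mh i) (hM i)) -RintegralD//.
  by apply: eq_Rintegral => w _; rewrite big_cons mulrDr.
rewrite (_ : _ \o _ = (fun w => \sum_(j <- s) (Z w * (c j * h j w))%:E)%E).
  by apply: integrable_sum => // j _; exact: H.
by apply/funext => w /=; rewrite mulr_sumr sumEFin.
Qed.

Lemma weighted_mean_norm_le g h M N :
  measurable_fun setT g -> measurable_fun setT h ->
  (forall w, `|g w| <= M) -> (forall w, `|h w| <= N) ->
  (forall w, `|g w| <= h w) -> `|weighted_mean g| <= weighted_mean h.
Proof.
move=> mg mh gM hN gh; rewrite (le_trans (le_normr_Rintegral _ _))//.
  exact: integrable_weight gM.

apply: le_Rintegral => //.
- have := integrable_weight (measurableT_comp (@normr_measurable R setT) mg) _.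
  move=> /(_ M); rewrite (_ : _ \o _ = EFin \o (fun t => `|Z t * g t|)).
    by apply=> w; rewrite /= normr_id.
  by apply/funext => w /=; rewrite normrM; congr (_ * _)%:E; rewrite ger0_norm//; case: hZ.
- exact: integrable_weight hN.
- move=> w _; have [_ Z0 _] := hZ.
  by rewrite normrM (ger0_norm (Z0 w)) ler_wpM2l.
Qed.

Variables (n : nat) (Y : 'I_n -> T -> R).

Definition weighted_laplace (alpha : 'I_n -> R) :=
  weighted_mean (fun w => expR (- \sum_k alpha k * Y k w)).

Hypotheses (mY : forall k, measurable_fun setT (Y k)) (Y0 : forall k w, 0 <= Y k w).

Lemma measurable_laplace (alpha : 'I_n -> R) :
  measurable_fun setT (fun w => expR (- \sum_k alpha k * Y k w)).
Proof.
apply: measurableT_comp => //; apply: measurableT_comp => //.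
by apply: measurable_sum => k; exact: measurable_funM.
Qed.

Lemma norm_laplace_le1 (alpha : 'I_n -> R) w : (forall k, 0 <= alpha k) ->
  `|expR (- \sum_k alpha k * Y k w)| <= 1.
Proof.
move=> a0; rewrite ger0_norm ?expR_ge0// expRN_le1//.
by apply: sumr_ge0 => k _; rewrite mulr_ge0.
Qed.

(** Exponents carried by one coordinate: they turn the tail terms of [exponential_approx] into
    values of the Laplace transform. *)
Definition single (s : R) (k j : 'I_n) : R := if j == k then s else 0.

Lemma sum_single s k w : \sum_j single s k j * Y j w = s * Y k w.
Proof.
rewrite (bigD1 k)//= /single eqxx big1 ?addr0// => j /negPf ->.
by rewrite mul0r.
Qed.

(** Each exp(-2^-i Y_k) tends to 1 under the domination of Z. This expresses the tightness of a
    single law in terms of its Laplace transform. *)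
Lemma cvg_tail (C : R) :
  \sum_k C * (1 - weighted_laplace (single (2 ^- i) k)) @[i --> \oo] --> (0 : R).
Proof.
have [iZ Z0 Z1] := hZ.
have H k : weighted_laplace (single (2 ^- i) k) @[i --> \oo] --> (1 : R).
  have p0 i : 0 <= (2 ^- i : R) by rewrite invr_ge0 exprn_ge0.
  have [] := @dominated_convergence _ _ _ mu setT measurableT
    (fun i w => (Z w * expR (- \sum_j single (2 ^- i) k j * Y j w))%:E)
    (EFin \o Z) (EFin \o Z).
  - by move=> i; apply/measurable_EFinP/measurable_funM => //; exact: measurable_laplace.
  - exact/measurable_EFinP.
  - apply: aeW => w _; apply/fine_cvgP; split; first exact: nearW.
    rewrite -[X in _ --> X]mulr1; apply: cvgMl_tmp => /=.
    under eq_fun do rewrite sum_single mulrC.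
    exact: cvg_expRN_div_exp2.
  - by [].
  - apply: aeW => w i _; rewrite abse_EFin lee_fin normrM (ger0_norm (Z0 w)) ler_piMr//.
    by apply: norm_laplace_le1 => j; rewrite /single; case: ifP.
  have -> : (\int[mu]_w (EFin \o Z) w)%E = 1%:E.
    by rewrite -Z1 fineK// integrable_fin_num.
  move=> _ _ H; exact: (fine_cvg H).
rewrite [X in _ --> X](_ : _ = \sum_(k < n) C * (1 - 1)); last first.
  by rewrite big1// => k _; rewrite subrr mulr0.
apply: cvg_sumr => k; apply: cvgMl_tmp; apply: cvgB; [exact: cvg_cst|exact: H].
Qed.

(** The exponential sums with eps = s = 2^-i converge pointwise to f, so measurability passes to the
    limit without any sigma-algebra on row vectors. *)
Lemma measurable_continuous_rV (f : 'rV[R]_n -> R) M : continuous f ->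
  (forall u, `|f u| <= M) -> measurable_fun setT (fun w => f (\row_k Y k w)).
Proof.
move=> cf fM.
have p0 i : 0 < (2 ^- i : R) by rewrite invr_gt0 exprn_gt0.
have H i := exponential_approx cf fM (p0 i) (p0 i).
have {}H i : exists p : ('I_n -> R) -> R,
    measurable_fun setT (fun w => p (Y ^~ w)) /\
    forall y, (forall k, 0 <= y k) -> `|f (\row_k y k) - p y| <=
      2 ^- i + 4 * M * \sum_k (1 - expR (- (2 ^- i * y k))).
  have [m [c Hc]] := H i.
  exists (fun y => \sum_(e : {ffun 'I_n -> 'I_m.+1})
    c e * expR (- \sum_i (e i)%:R * y i)); split => //.
  apply: measurable_sum => e; apply: measurable_funM => //.
  exact: (measurable_laplace (fun k => (e k)%:R)).
have [p Hp] := choice H.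
apply: (@measurable_realfun.measurable_fun_cvg _ _ _ _
    (fun i w => p i (Y ^~ w))) => [i|w _]; first by case: (Hp i).
have tail : 2 ^- i + 4 * M * \sum_k (1 - expR (- (2 ^- i * Y k w)))
    @[i --> \oo] --> (0 : R).
  rewrite -[X in _ --> X]addr0; apply: cvgD.
    by have := cvg_div_exp2 (1 : R); under eq_fun do rewrite mul1r.
  rewrite -[X in _ --> X](mulr0 (4 * M)); apply: cvgMl_tmp.
  rewrite [X in _ --> X](_ : _ = \sum_(k < n) (1 - 1)); last first.
    by rewrite big1// => k _; rewrite subrr.
  apply: cvg_sumr => k; apply: cvgB; first exact: cvg_cst.
  by under eq_fun do rewrite mulrC; exact: cvg_expRN_div_exp2.
apply/cvgrPdist_le => e e0; move/cvgrPdist_le : tail => /(_ _ e0).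
apply: filterS => i; rewrite sub0r normrN => Hi.
by rewrite (le_trans _ Hi)// (le_trans ((Hp i).2 (Y ^~ w) _))// ler_norm.
Qed.

(** The pointwise bound is integrated, eps being unchanged because Z dmu has mass 1. Both the
    approximant and the error then depend on the law only through its Laplace transform. *)
Lemma weighted_mean_approx (f : 'rV[R]_n -> R) M (eps s C : R) m
    (c : {ffun 'I_n -> 'I_m.+1} -> R) :
  continuous f -> (forall u, `|f u| <= M) -> 0 <= s ->
  (forall y, (forall i, 0 <= y i) ->
    `|f (\row_i y i) - \sum_(e : {ffun 'I_n -> 'I_m.+1})
        c e * expR (- \sum_i (e i)%:R * y i)|
    <= eps + C * \sum_i (1 - expR (- (s * y i)))) ->
  `|weighted_mean (fun w => f (\row_k Y k w)) -
    \sum_e c e * weighted_laplace (fun k => (e k)%:R)| <=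
  eps + \sum_k C * (1 - weighted_laplace (single s k)).
Proof.
move=> cf fM s0 fp.
have mf := measurable_continuous_rV cf fM.
have ml e w : `|expR (- \sum_i ((e : {ffun 'I_n -> 'I_m.+1}) i)%:R * Y i w)| <= 1.
  exact: (@norm_laplace_le1 (fun k => (e k)%:R)).
have ms k w : `|expR (- \sum_j single s k j * Y j w)| <= 1.
  by apply: norm_laplace_le1 => j; rewrite /single; case: ifP.
rewrite -(weighted_mean_sum _ _ (fun e : {ffun 'I_n -> 'I_m.+1} =>
  measurable_laplace (fun k => (e k)%:R)) ml).
have mp : measurable_fun setT (fun w => \sum_(e : {ffun 'I_n -> 'I_m.+1})
    c e * expR (- \sum_i (e i)%:R * Y i w)).
  apply: measurable_sum => e; apply: measurable_funM => //.
  exact: (measurable_laplace (fun k => (e k)%:R)).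
have bp w : `|\sum_(e : {ffun 'I_n -> 'I_m.+1})
    c e * expR (- \sum_i (e i)%:R * Y i w)| <= \sum_e `|c e|.
  rewrite (le_trans (ler_norm_sum _ _ _))//; apply: ler_sum => e _.
  by rewrite normrM ler_piMr.
rewrite -(weighted_meanB mf mp (fun w => fM _) bp).
have -> : eps + \sum_k C * (1 - weighted_laplace (single s k)) =
    weighted_mean (fun w => (eps + \sum_(k < n) C) -
      \sum_k C * expR (- \sum_j single s k j * Y j w)).
  have bs w : `|\sum_k C * expR (- \sum_j single s k j * Y j w)| <= \sum_(k < n) `|C|.
    rewrite (le_trans (ler_norm_sum _ _ _))//; apply: ler_sum => k _.
    by rewrite normrM ler_piMr.
  rewrite (weighted_meanB _ _ (fun w => lexx `|eps + \sum_(k < n) C|) bs)//; last first.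
    by apply: measurable_sum => k; apply: measurable_funM => //; exact: measurable_laplace.
  rewrite (weighted_mean_sum _ _ (fun k => measurable_laplace (single s k)) ms).
  rewrite weighted_mean_cst.
  rewrite -addrA -sumrB; congr (_ + _).
  by apply: eq_bigr => k _; rewrite mulrBr mulr1.
have sE w : (eps + \sum_(k < n) C) - \sum_k C * expR (- \sum_j single s k j * Y j w) =
    eps + C * \sum_k (1 - expR (- (s * Y k w))).
  rewrite -addrA -sumrB mulr_sumr; congr (_ + _); apply: eq_bigr => k _.
  by rewrite sum_single mulrBr mulr1.
have mg : measurable_fun setT (fun w => (eps + \sum_(k < n) C) -
    \sum_k C * expR (- \sum_j single s k j * Y j w)).
  apply: measurable_funB => //; apply: measurable_sum => k.
  by apply: measurable_funM => //; exact: measurable_laplace.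
(* These crude bounds serve integrability alone and do not enter the estimate. *)
apply: (@weighted_mean_norm_le _ _ (M + \sum_e `|c e|)
    (`|eps + \sum_(k < n) C| + \sum_(k < n) `|C|) _ mg).
- exact: measurable_funB.
- by move=> w; rewrite (le_trans (ler_normB _ _))// lerD.
- move=> w; rewrite (le_trans (ler_normB _ _))// lerD//.
  rewrite (le_trans (ler_norm_sum _ _ _))//; apply: ler_sum => k _.
  by rewrite normrM ler_piMr.
- by move=> w; rewrite sE; exact: (fp (Y ^~ w)).
Qed.

End weighted_mean.

(** The order of choices matters: s makes the tail of the limit law small, the exponential sum is
    fixed for that s, and only then is i taken far along F. The tails at i are close to that of the
    limit by convergence of the transforms. *)
Lemma laplace_continuity (R : realType) (n : nat) (I : Type) (F : set_system I)
    {FF : Filter F}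
    (d_ : I -> measure_display) (T_ : forall i, measurableType (d_ i))
    (mu_ : forall i, {measure set (T_ i) -> \bar R})
    (Z_ : forall i, T_ i -> R) (Y_ : forall i, 'I_n -> T_ i -> R)
    d (T : measurableType d) (mu : {measure set T -> \bar R})
    (Z : T -> R) (Y : 'I_n -> T -> R) (f : 'rV[R]_n -> R) (M : R) :
  (\forall i \near F, [/\ probability_weight (mu_ i) (Z_ i),
     forall k, measurable_fun setT (Y_ i k) & forall k w, 0 <= Y_ i k w]) ->
  probability_weight mu Z ->
  (forall k, measurable_fun setT (Y k)) -> (forall k w, 0 <= Y k w) ->
  (forall alpha, (forall k, 0 <= alpha k) ->
     weighted_laplace (mu_ i) (Z_ i) (Y_ i) alpha @[i --> F] -->
     weighted_laplace mu Z Y alpha) ->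
  continuous f -> (forall u, `|f u| <= M) ->
  weighted_mean (mu_ i) (Z_ i) (fun w => f (\row_k Y_ i k w)) @[i --> F] -->
  weighted_mean mu Z (fun w => f (\row_k Y k w)).
Proof.
move=> good hZ mY Y0 cvgL cf fM; apply/cvgrPdist_le => e e0.
(* Six errors of e/8 add up: two for the limit mean against its sum, one between the sums, three for
   the mean at i, whose tail is compared with the limit tail. *)
have e8 : 0 < e / 8 by rewrite divr_gt0.
have /cvgrPdist_le /(_ _ e8) := cvg_tail hZ mY Y0 (4 * M).
move=> [N _ /(_ N (leqnn N))]; rewrite /= sub0r normrN; set s := 2 ^- N => tail.
have s0 : 0 < s by rewrite invr_gt0 exprn_gt0.
have [m [c Hc]] := exponential_approx cf fM e8 s0.
have cvgP : \sum_(e : {ffun 'I_n -> 'I_m.+1})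
      c e * weighted_laplace (mu_ i) (Z_ i) (Y_ i) (fun k => (e k)%:R) @[i --> F] -->
    \sum_(e : {ffun 'I_n -> 'I_m.+1}) c e * weighted_laplace mu Z Y (fun k => (e k)%:R).
  by apply: cvg_sumr => p; apply: cvgMl_tmp; exact: cvgL.
have cvgT : \sum_k 4 * M * (1 - weighted_laplace (mu_ i) (Z_ i) (Y_ i) (single s k))
      @[i --> F] -->
    \sum_k 4 * M * (1 - weighted_laplace mu Z Y (single s k)).
  apply: cvg_sumr => k; apply: cvgMl_tmp; apply: cvgB; first exact: cvg_cst.
  by apply: cvgL => j; rewrite /single; case: ifP => // _; exact: ltW.
move/cvgrPdist_le : cvgP => /(_ _ e8) cvgP.
move/cvgrPdist_le : cvgT => /(_ _ e8) cvgT.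
have lim_le := weighted_mean_approx hZ mY Y0 cf fM (ltW s0) Hc.
move: good cvgP cvgT; apply: filterS3 => i [hZi mYi Yi0].
have := weighted_mean_approx hZi mYi Yi0 cf fM (ltW s0) Hc.
move: lim_le tail.
set A := weighted_mean _ _ _; set Ai := weighted_mean (mu_ i) _ _.
set p := \sum_e _; set t := \sum_k _; set pi := \sum_e _; set ti := \sum_k _.
rewrite !ler_norml => /andP[? ?] /andP[? ?] /andP[? ?] /andP[? ?] /andP[? ?].
by apply/andP; split; lra.
Qed.

(** * Processes *)

Lemma measurable_coord (R : realType) (E : Type) (x : E) :
  measurable_fun setT (fun y : nnpath R E => (y x)%:num).
Proof.
move=> _ B mB; rewrite setTI; apply: sub_sigma_algebra.
by exists x, B.
Qed.

Lemma measurable_path_coord (R : realType) (E : Type) d (T : measurableType d)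
    (P : probability T R) (psi : {RV P >-> nnpath R E}) (x : E) :
  measurable_fun setT (fun w => (psi w x)%:num).
Proof. exact: (measurableT_comp (measurable_coord x) (measurable_funPT psi)). Qed.

(** * From identities on measurable sets to identities on nonnegative functions *)

Section weighted_integral.
Import HBNNSimple.
Local Open Scope ereal_scope.

Lemma ge0_weighted_integral_simple (R : realType) d (T : measurableType d)
    (mu : {measure set T -> \bar R}) (Z : T -> R)
    d' (S : measurableType d') (X : T -> S) (s : {nnsfun S >-> R}) :
  measurable_fun setT Z -> (forall w, 0 <= Z w)%R -> measurable_fun setT X ->
  \int[mu]_w (Z w * s (X w))%:E =
  \sum_(y \in range s) y%:E * \int[mu]_w (Z w * \1_(s @^-1` [set y]) (X w))%:E.
Proof.
move=> mZ Z0 mX.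
have mI y : measurable_fun setT (fun w => (Z w * \1_(s @^-1` [set y]) (X w))%:E).
  apply/measurable_EFinP; apply: measurable_funM => //.
  by apply: measurableT_comp mX; exact: measurable_indic.
(* Here y is any real, possibly negative; the indicator vanishes unless y is a value of s, hence
   nonnegative. *)
have ge0 y w : 0 <= (y * (Z w * \1_(s @^-1` [set y]) (X w)))%:E.
  rewrite lee_fin indicE; case: (boolP (_ \in _)) => [|_]; last by rewrite !mulr0.
  by rewrite inE /= => <-; rewrite mulr1 mulr_ge0//; exact: fun_ge0.
have -> : \int[mu]_w (Z w * s (X w))%:E =
    \int[mu]_w \sum_(y \in range s) (y * (Z w * \1_(s @^-1` [set y]) (X w)))%:E.
  apply: eq_integral => w _; rewrite [in LHS](fimfunE s) fsumEFin//.
  rewrite !fsbig_finite//= mulr_sumr; congr EFin.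
  by apply: eq_bigr => y _; rewrite mulrCA.
rewrite ge0_integral_fsum//; last first.
  by move=> y; under eq_fun do rewrite EFinM; exact: measurable_funeM.
apply: eq_fsbigr => y /set_mem [v _ <-].
rewrite -ge0_integralZl_EFin//.
by move=> w _; rewrite lee_fin mulr_ge0// indicE.
Qed.

(** Simple functions and monotone convergence. Independence and size-biasing are stated on sets;
    this carries them over to exponentials. *)
Lemma eq_weighted_integral (R : realType)
    d1 (T1 : measurableType d1) (mu1 : {measure set T1 -> \bar R}) (Z1 : T1 -> R)
    d2 (T2 : measurableType d2) (mu2 : {measure set T2 -> \bar R}) (Z2 : T2 -> R)
    d (S : measurableType d) (X1 : T1 -> S) (X2 : T2 -> S) (G : S -> R) :
  measurable_fun setT Z1 -> (forall w, 0 <= Z1 w)%R -> measurable_fun setT X1 ->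
  measurable_fun setT Z2 -> (forall w, 0 <= Z2 w)%R -> measurable_fun setT X2 ->
  (forall A, measurable A ->
    \int[mu1]_w (Z1 w * \1_A (X1 w))%:E = \int[mu2]_w (Z2 w * \1_A (X2 w))%:E) ->
  measurable_fun setT G -> (forall x, 0 <= G x)%R ->
  \int[mu1]_w (Z1 w * G (X1 w))%:E = \int[mu2]_w (Z2 w * G (X2 w))%:E.
Proof.
move=> mZ1 Z10 mX1 mZ2 Z20 mX2 HA mG G0.
have mG' : measurable_fun setT (EFin \o G) by exact/measurable_EFinP.
pose s := nnsfun_approx measurableT mG'.
have H d' (T : measurableType d') (mu : {measure set T -> \bar R}) (Z : T -> R)
    (X : T -> S) : measurable_fun setT Z -> (forall w, 0 <= Z w)%R ->
    measurable_fun setT X ->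
    \int[mu]_w (Z w * s n (X w))%:E @[n --> \oo] --> \int[mu]_w (Z w * G (X w))%:E.
  move=> mZ Z0 mX.
  have Hw w : (Z w * s n (X w))%:E @[n --> \oo] --> (Z w * G (X w))%:E.
    under eq_fun do rewrite EFinM; rewrite EFinM; apply: cvgeZl => //.
    by apply: cvg_nnsfun_approx => // x _; rewrite lee_fin.
  under [X in _ --> X]eq_integral => w _ do rewrite -(cvg_lim _ (Hw w))//.
  apply: cvg_monotone_convergence => //.
  - move=> n; apply/measurable_EFinP; apply: measurable_funM => //.
    exact: measurableT_comp mX.
  - by move=> n w _; rewrite lee_fin mulr_ge0//; exact: fun_ge0.
  - move=> w _ m n mn; rewrite lee_fin ler_wpM2l//.
    exact/lefP/nd_nnsfun_approx.
apply: (cvg_unique _ (H _ _ _ _ _ mZ1 Z10 mX1)); first exact: ereal_hausdorff.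
rewrite (_ : (fun n => _) = (fun n => \int[mu2]_w (Z2 w * s n (X2 w))%:E)).
  exact: H.
apply/funext => n; rewrite !ge0_weighted_integral_simple//.
by apply: eq_fsbigr => y _; rewrite HA.
Qed.

End weighted_integral.

Section path_laplace.
Context {R : realType} {E : Type} (n : nat).
Implicit Types (alpha : 'I_n -> R) (x : 'I_n -> E) (y : nnpath R E).

Definition path_exp alpha x y : R :=
  expR (- \sum_(k < n) alpha k * (y (x k))%:num).

Lemma measurable_path_exp alpha x : measurable_fun setT (path_exp alpha x).
Proof.
apply: measurableT_comp => //; apply: measurableT_comp => //.
apply: measurable_sum => k; apply: measurable_funM => //.
exact: measurable_coord.
Qed.

Lemma path_exp_gt0 alpha x y : (0 < path_exp alpha x y)%R.
Proof. exact: expR_gt0. Qed.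

Lemma path_exp_le1 alpha x y : (forall k, 0 <= alpha k)%R -> (path_exp alpha x y <= 1)%R.
Proof.
by move=> a0; apply: expRN_le1; apply: sumr_ge0 => k _; rewrite mulr_ge0.
Qed.

Lemma path_exp_add alpha x y z :
  path_exp alpha x (path_add y z) = (path_exp alpha x y * path_exp alpha x z)%R.
Proof.
rewrite /path_exp -expRD -opprD -big_split; congr (expR (- _))%R.
by apply: eq_bigr => k _; rewrite /= mulrDr.
Qed.

End path_laplace.

Section process.
Context {R : realType} {E : Type} d {Omega : measurableType d}
  {P : probability Omega R}.
Implicit Types (psi r : {RV P >-> nnpath R E}) (a : E)
  (nu : {measure set (nnpath R E) -> \bar R}).
Local Open Scope ereal_scope.

(** Prepending the point a with coefficient t yields the one-parameter family to be differentiated.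
    It also makes the number of points positive, so n = 0 is allowed. *)
Lemma laplace_formula_cons psi nu a n (alpha : 'I_n -> R) (x : 'I_n -> E) t :
  laplace_formula psi nu -> (forall k, 0 <= alpha k)%R -> (0 <= t)%R ->
  \int[P]_w (expR (- (t * (psi w a)%:num + \sum_(k < n) alpha k * (psi w (x k))%:num)))%:E =
  expeR (- \int[nu]_y
    (1 - expR (- (t * (y a)%:num + \sum_(k < n) alpha k * (y (x k))%:num)))%:E).
Proof.
move=> LK a0 t0.
pose alpha' (i : 'I_n.+1) := if unlift ord0 i is Some j then alpha j else t.
pose x' (i : 'I_n.+1) := if unlift ord0 i is Some j then x j else a.
have := LK n.+1 alpha' x' isT _; rewrite unlock => LK'.
have sumE (y : nnpath R E) : (\sum_(i < n.+1) alpha' i * (y (x' i))%:num =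
    t * (y a)%:num + \sum_(k < n) alpha k * (y (x k))%:num)%R.
  rewrite big_ord_recl /alpha' /x' unlift_none; congr (_ + _)%R.
  by apply: eq_bigr => i _; rewrite liftK.
under eq_integral do rewrite -sumE.
under [in RHS]eq_integral do rewrite -sumE.
by apply: LK' => i; rewrite /alpha'; case: unliftP.
Qed.

Lemma laplace_formulaE psi nu a n (alpha : 'I_n -> R) (x : 'I_n -> E) :
  laplace_formula psi nu -> (forall k, 0 <= alpha k)%R ->
  \int[P]_w (path_exp alpha x (psi w))%:E =
  expeR (- \int[nu]_y (1 - path_exp alpha x y)%:E).
Proof.
move=> LK a0; have := laplace_formula_cons a x LK a0 (lexx 0%R).
under eq_integral do rewrite mul0r add0r.
by under [in X in _ = X -> _]eq_integral do rewrite mul0r add0r.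
Qed.

Lemma size_biased_laplace psi nu a n (alpha : 'I_n -> R) (x : 'I_n -> E) :
  laplace_formula psi nu -> (forall k, 0 <= alpha k)%R ->
  \int[P]_w ((psi w a)%:num * path_exp alpha x (psi w))%:E =
  \int[P]_w (path_exp alpha x (psi w))%:E *
  \int[nu]_y ((y a)%:num * path_exp alpha x y)%:E.
Proof.
move=> LK a0.
apply: (derive_levy_khinchine (f := fun y : nnpath R E => (y a)%:num)
  (g := fun y : nnpath R E => (\sum_(k < n) alpha k * (y (x k))%:num)%R)) => //.
- exact: measurable_path_coord.
- by apply: measurable_sum => k; apply: measurable_funM => //; exact: measurable_path_coord.
- by move=> w; apply: sumr_ge0 => k _; rewrite mulr_ge0.
- exact: measurable_coord.
- by apply: measurable_sum => k; apply: measurable_funM => //; exact: measurable_coord.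
- by move=> w; apply: sumr_ge0 => k _; rewrite mulr_ge0.
- by move=> t t0; exact: laplace_formula_cons.
Qed.

Lemma mean_at_levy psi nu a : laplace_formula psi nu ->
  mean_at psi a = \int[nu]_y ((y a)%:num)%:E.
Proof.
move=> LK.
(* With an empty family of points the exponential factor is identically 1. *)
pose x : 'I_0 -> E := fun=> a; pose alpha : 'I_0 -> R := fun=> 0%R.
have E1 y : path_exp alpha x y = 1%R by rewrite /path_exp big_ord0 oppr0 expR0.
have := size_biased_laplace a x LK (fun k => lexx (alpha k)).
under eq_integral do rewrite E1 mulr1.
under [X in X * _]eq_integral do rewrite E1.
under [X in _ * X]eq_integral do rewrite E1 mulr1.
have -> : \int[P]_w 1%:E = 1.
  by rewrite integral_cst// mul1e; exact: probability_setT.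
by rewrite mul1e /mean_at unlock.
Qed.

Lemma measurable_path_add psi r :
  measurable_fun setT (fun w => path_add (psi w) (r w) : nnpath R E).
Proof.
apply: (@measurability _ _ _ (nnpath R E) setT _ (@cylinders R E)) => // _ [_ [x [B mB ->]] <-].
have : measurable_fun setT (fun w => (psi w x)%:num + (r w x)%:num)%R.
  by apply: measurable_funD; exact: measurable_path_coord.
by move=> /(_ measurableT B mB).
Qed.

Lemma size_weight_ge0 psi a w : (0 <= size_weight psi a w)%R.
Proof.
rewrite /size_weight divr_ge0// fine_ge0// /mean_at unlock.
by apply: integral_ge0 => ? _; rewrite lee_fin.
Qed.

Lemma measurable_size_weight psi a : measurable_fun setT (size_weight psi a).
Proof. by apply: measurable_funM => //; exact: measurable_path_coord. Qed.

(** The product rule on rectangles is extended one factor at a time: to G(psi) with the indicator of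
    B at r as weight, then to H(r) with G(psi) as weight. The other side carries its constant as a
    constant weight, whence the finiteness of the integral of G(psi). *)
Lemma independent_integralM psi r (G H : nnpath R E -> R) :
  independent_processes psi r ->
  measurable_fun setT G -> (forall y, 0 <= G y)%R ->
  measurable_fun setT H -> (forall y, 0 <= H y)%R ->
  \int[P]_w (G (psi w))%:E \is a fin_num ->
  \int[P]_w (G (psi w) * H (r w))%:E =
  \int[P]_w (G (psi w))%:E * \int[P]_w (H (r w))%:E.
Proof.
move=> ind mG G0 mH H0 Gfin.
have mpsi : measurable_fun setT psi by exact: measurable_funPT.
have mr : measurable_fun setT r by exact: measurable_funPT.
have mGpsi : measurable_fun setT (fun w => G (psi w)) by exact: measurableT_comp mpsi.
have indr B : measurable B -> \int[P]_w (G (psi w) * \1_B (r w))%:E =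
    \int[P]_w (G (psi w))%:E * P (r @^-1` B).
  move=> mB.
  have mrB : measurable (r @^-1` B) by rewrite -[X in measurable X]setTI; exact: mr.
  under eq_integral do rewrite mulrC.
  rewrite (@eq_weighted_integral _ _ _ _ _ _ _ P (fun=> fine (P (r @^-1` B))) _ _
    psi psi G)//.
  - under eq_integral do rewrite EFinM.
    rewrite ge0_integralZl_EFin ?fine_ge0//; last 2 first.
      by move=> w _; rewrite lee_fin.
      exact/measurable_EFinP.
    by rewrite fineK ?fin_num_measure// muleC.
  - by apply: measurableT_comp mr; exact: measurable_indic.
  - by move=> w; rewrite fine_ge0.
  move=> A mA.
  have mpsiA : measurable (psi @^-1` A) by rewrite -[X in measurable X]setTI; exact: mpsi.
  transitivity (P (psi @^-1` A `&` r @^-1` B)).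
    rewrite -[X in P X]setIT -integral_indic//; last exact: measurableI.
    by apply: eq_integral => w _; rewrite indicI mulrC.
  rewrite ind// -[X in P X * _]setIT -integral_indic// muleC.
  rewrite -[X in X * _]fineK ?fin_num_measure// -ge0_integralZl_EFin//; last 2 first.
    exact/measurable_EFinP.
    exact: fine_ge0.
have c0 : (0 <= fine (\int[P]_w (G (psi w))%:E))%R.
  by rewrite fine_ge0// integral_ge0// => w _; rewrite lee_fin.
rewrite (@eq_weighted_integral _ _ _ P _ _ _ P
  (fun=> fine (\int[P]_w (G (psi w))%:E)) _ _ r r H)//.
- under eq_integral do rewrite EFinM.
  rewrite ge0_integralZl_EFin ?fineK//.
  + by move=> w _; rewrite lee_fin.
  + by apply/measurable_EFinP; exact: measurableT_comp mr.
move=> B mB; rewrite indr//.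
under [RHS]eq_integral do rewrite EFinM.
rewrite ge0_integralZl_EFin ?fineK//.
- congr (_ * _); rewrite -[X in P X]setIT -integral_indic//.
  by rewrite -[X in measurable X]setTI; exact: mr.
- apply/measurable_EFinP; apply: measurableT_comp mr; exact: measurable_indic.
Qed.

Lemma size_bias_integral psi a r (G : nnpath R E -> R) :
  size_bias_increment psi a r ->
  measurable_fun setT G -> (forall y, 0 <= G y)%R ->
  \int[P]_w (G (path_add (psi w) (r w)))%:E =
  \int[P]_w (size_weight psi a w * G (psi w))%:E.
Proof.
move=> [_ law] mG G0.
have mpsi : measurable_fun setT psi by exact: measurable_funPT.
rewrite -(@eq_weighted_integral _ _ _ P (fun=> 1%R) _ _ P (size_weight psi a) _ _
  (fun w => path_add (psi w) (r w) : nnpath R E) psi G)//.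
- by under [RHS]eq_integral do rewrite mul1r.
- exact: measurable_path_add.
- exact: measurable_size_weight.
- exact: size_weight_ge0.
move=> A mA; have := law A mA; rewrite /mean_under unlock => <-.
under eq_integral do rewrite mul1r.
rewrite -[X in P X]setIT -integral_indic//.
rewrite -[X in measurable X]setTI.
exact: (measurable_path_add psi r).
Qed.

End process.

(** * Laplace transforms of the increment and of the size-biased processes *)

Section levy_moments.
Context {R : realType} {E : Type} d {Omega : measurableType d}
  {P : probability Omega R}.
Implicit Type r : {RV P >-> nnpath R E}.
Local Open Scope ereal_scope.

Variables (psi : {RV P >-> nnpath R E})
  (nu : {measure set (nnpath R E) -> \bar R}) (a : E).
Hypotheses (LK : laplace_formula psi nu) (ha : 0 < mean_at psi a < +oo).

Definition levy_moment n (alpha : 'I_n -> R) (x : 'I_n -> E) : R :=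
  fine (\int[nu]_y ((y a)%:num * path_exp alpha x y)%:E).

Definition levy_exponent n (alpha : 'I_n -> R) (x : 'I_n -> E) : R :=
  fine (\int[nu]_y (1 - path_exp alpha x y)%:E).

Let m := fine (mean_at psi a).

Lemma mean_atE : mean_at psi a = m%:E.
Proof.
rewrite /m fineK// ge0_fin_numE; first by case/andP: ha.
by apply: ltW; case/andP: ha.
Qed.

Lemma mean_gt0 : (0 < m)%R.
Proof. by rewrite -lte_fin -mean_atE; case/andP: ha. Qed.

(** Dropping the exponential bounds the integral by the mean of psi at a, which is finite. *)
Lemma levy_momentE n (alpha : 'I_n -> R) (x : 'I_n -> E) :
  (forall k, 0 <= alpha k)%R ->
  \int[nu]_y ((y a)%:num * path_exp alpha x y)%:E = (levy_moment alpha x)%:E.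
Proof.
move=> a0; rewrite /levy_moment fineK// ge0_fin_numE; last first.
  by apply: integral_ge0 => y _; rewrite lee_fin mulr_ge0// ltW// path_exp_gt0.
apply: (@le_lt_trans _ _ (\int[nu]_y ((y a)%:num)%:E)); last first.
  by rewrite -(mean_at_levy a LK); case/andP: ha.
apply: ge0_le_integral => //.
- by move=> y _; rewrite lee_fin mulr_ge0// ltW// path_exp_gt0.
- apply/measurable_EFinP/measurable_funM; first exact: measurable_coord.
  exact: measurable_path_exp.
- by apply/measurable_EFinP; exact: measurable_coord.
- by move=> y _; rewrite lee_fin ler_piMr// path_exp_le1.
Qed.

Lemma levy_exponentE n (alpha : 'I_n -> R) (x : 'I_n -> E) :
  (forall k, 0 <= alpha k)%R ->
  \int[nu]_y (1 - path_exp alpha x y)%:E = (levy_exponent alpha x)%:E.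
Proof.
move=> a0; rewrite /levy_exponent fineK// ge0_fin_numE; last first.
  by apply: integral_ge0 => y _; rewrite lee_fin subr_ge0 path_exp_le1.
rewrite ltey; apply/eqP => oo.
have : 0 < \int[P]_w (path_exp alpha x (psi w))%:E.
  apply: integral_expRN_gt0; apply: measurable_sum => k.
  by apply: measurable_funM => //; exact: measurable_path_coord.
by rewrite (laplace_formulaE a x LK a0) oo /= ltxx.
Qed.

(* The Laplace transform of r does not involve psi: divide the size-biasing
   identity by the Laplace transform of psi. *)
Lemma increment_laplace r n (alpha : 'I_n -> R) (x : 'I_n -> E) :
  size_bias_increment psi a r -> (forall k, 0 <= alpha k)%R ->
  \int[P]_w (path_exp alpha x (r w))%:E = (levy_moment alpha x / m)%:E.
Proof.
move=> hr a0.
have mG := @measurable_path_exp R E n alpha x.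
have G0 y : (0 <= path_exp alpha x y)%R by rewrite ltW// path_exp_gt0.
have LE : \int[P]_w (path_exp alpha x (psi w))%:E = (expR (- levy_exponent alpha x))%:E.
  by rewrite (laplace_formulaE a x LK a0) levy_exponentE.
have := size_bias_integral hr mG G0.
under eq_integral do rewrite path_exp_add.
rewrite independent_integralM// ?LE//; last by case: hr.
under [RHS]eq_integral do rewrite /size_weight -/m mulrAC mulrC EFinM.
rewrite ge0_integralZl_EFin//; last 3 first.
- by move=> w _; rewrite lee_fin mulr_ge0.
- apply/measurable_EFinP/measurable_funM; first exact: measurable_path_coord.
  by apply: measurableT_comp => //; exact: measurable_funPT.
- by rewrite invr_ge0 ltW// mean_gt0.
rewrite (size_biased_laplace a x LK a0) LE levy_momentE// muleCA -EFinM.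
move/(congr1 (fun z => (expR (- levy_exponent alpha x))^-1%:E * z)).
rewrite !muleA -!EFinM mulVf ?gt_eqF ?expR_gt0//.
rewrite mul1e mulKf ?gt_eqF ?expR_gt0// => ->.
by rewrite mulrC.
Qed.

(* The factor delta cancels between the Levy moment and the mean. *)
Lemma size_biased_laplace_scaled (delta : R) (delta_gt0 : (0 < delta)%R)
    d' (Omega' : measurableType d') (P' : probability Omega' R)
    (psi' : {RV P' >-> nnpath R E}) n (alpha : 'I_n -> R) (x : 'I_n -> E) :
  laplace_formula psi' (mscale (NngNum (ltW delta_gt0)) nu) ->
  (forall k, 0 <= alpha k)%R ->
  \int[P']_w (size_weight psi' a w * path_exp alpha x (psi' w))%:E =
  (expR (- (delta * levy_exponent alpha x)) * (levy_moment alpha x / m))%:E.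
Proof.
move=> LK' a0.
have G0 y : (0 <= path_exp alpha x y)%R by rewrite ltW// path_exp_gt0.
have mG := @measurable_path_exp R E n alpha x.
have m0 := mean_gt0.
have mE : fine (mean_at psi' a) = (delta * m)%R.
  rewrite (mean_at_levy a LK') ge0_integral_mscale//; last first.
    by apply/measurable_EFinP; exact: measurable_coord.
  by rewrite -(mean_at_levy a LK) mean_atE.
have LE : \int[P']_w (path_exp alpha x (psi' w))%:E =
    (expR (- (delta * levy_exponent alpha x)))%:E.
  rewrite (laplace_formulaE a x LK' a0) ge0_integral_mscale//.
  - by rewrite levy_exponentE.
  - by apply/measurable_EFinP; apply: measurable_funB.
  - by move=> y _; rewrite lee_fin subr_ge0 path_exp_le1.
under eq_integral do rewrite /size_weight mE mulrAC mulrC EFinM.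
rewrite ge0_integralZl_EFin//; last 3 first.
- by move=> w _; rewrite lee_fin mulr_ge0.
- apply/measurable_EFinP/measurable_funM; first exact: measurable_path_coord.
  by apply: measurableT_comp => //; exact: measurable_funPT.
- by rewrite invr_ge0 ltW// mulr_gt0.
rewrite (size_biased_laplace a x LK' a0) LE ge0_integral_mscale//.
- rewrite levy_momentE// -!EFinM; congr EFin => /=; field.
  by rewrite !gt_eqF.
- apply/measurable_EFinP/measurable_funM => //; exact: measurable_coord.
- by move=> y _; rewrite lee_fin mulr_ge0.
Qed.

(** Total mass 1 is the size-biased transform for an empty family of points, where the Levy exponent
    is 0 and the Levy moment is the mean. *)
Lemma size_weight_probability (delta : R) (delta_gt0 : (0 < delta)%R)
    d' (Omega' : measurableType d') (P' : probability Omega' R)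
    (psi' : {RV P' >-> nnpath R E}) :
  laplace_formula psi' (mscale (NngNum (ltW delta_gt0)) nu) ->
  probability_weight P' (size_weight psi' a).
Proof.
move=> LK'.
pose x : 'I_0 -> E := fun=> a; pose alpha : 'I_0 -> R := fun=> 0%R.
have E1 y : path_exp alpha x y = 1%R by rewrite /path_exp big_ord0 oppr0 expR0.
have int1 : \int[P']_w (size_weight psi' a w)%:E = 1.
  have := size_biased_laplace_scaled x LK' (fun k => lexx (alpha k)).
  under eq_integral do rewrite E1 mulr1.
  move=> ->; rewrite /levy_exponent /levy_moment.
  under eq_integral do rewrite E1 subrr.
  under [in X in (_ * (fine X / _))%R]eq_integral do rewrite E1 mulr1.
  rewrite integral0 /= mulr0 oppr0 expR0 mul1r -(mean_at_levy a LK).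
  by rewrite mulfV// gt_eqF// mean_gt0.
split.
- apply/integrableP; split; first exact/measurable_EFinP/measurable_size_weight.
  under eq_integral do rewrite gee0_abs ?lee_fin ?size_weight_ge0//.
  by rewrite int1 ltry.
- exact: size_weight_ge0.
- by rewrite /Rintegral int1.
Qed.

End levy_moments.

Theorem mainTheorem5 (R : realType) (E : Type)
    (nu : {measure set (nnpath R E) -> \bar R})
    (d : measure_display) (Omega : measurableType d)
    (P : probability Omega R) (psi : {RV P >-> nnpath R E})
    (hpsi : id_process_without_drift psi nu)
    (d' : R -> measure_display)
    (Omega' : forall delta : R, measurableType (d' delta))
    (P' : forall delta : R, probability (Omega' delta) R)
    (psi' : forall delta : R, {RV (P' delta) >-> nnpath R E})
    (hpsi' : forall (delta : R) (delta_gt0 : 0 < delta),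
      id_process_without_drift (psi' delta)
        (mscale (NngNum (ltW delta_gt0)) nu))
    (a : E) (ha : (0 < mean_at psi a < +oo)%E)
    (r : {RV P >-> nnpath R E}) (hr : size_bias_increment psi a r) :
  cvg_in_law 0^'+
    (fun delta G =>
       mean_under (P' delta) (size_weight (psi' delta) a) (G \o psi' delta))
    (fun G => 'E_P[G \o r])%E.
Proof.
move=> n x f cf [M fM]; have [_ LK _] := hpsi.
have LK' delta (delta_gt0 : 0 < delta) :
    laplace_formula (psi' delta) (mscale (NngNum (ltW delta_gt0)) nu).
  by case: (hpsi' delta delta_gt0).
pose Y delta k w := (psi' delta w (x k))%:num.
pose Yr k w := (r w (x k))%:num.
have mY delta k : measurable_fun setT (Y delta k) by exact: measurable_path_coord.
have mYr k : measurable_fun setT (Yr k) by exact: measurable_path_coord.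
have Y0 delta k w : 0 <= Y delta k w by rewrite /Y.
have Yr0 k w : 0 <= Yr k w by rewrite /Yr.
have hP : probability_weight P (fun=> 1).
  have P1 : (\int[P]_w 1%:E = 1)%E.
    by rewrite integral_cst// mul1e; exact: probability_setT.
  split => //; last by rewrite /Rintegral P1.
  exact: finite_measure_integrable_cst.
have weight delta : 0 < delta ->
    probability_weight (P' delta) (size_weight (psi' delta) a).
  by move=> delta_gt0; exact: (size_weight_probability LK ha (LK' _ delta_gt0)).
have limE : 'E_P[(fun y : nnpath R E => f (\row_k (y (x k))%:num)) \o r]%E =
    (weighted_mean P (fun=> 1) (fun w => f (\row_k Yr k w)))%:E.
  rewrite unlock /weighted_mean /Rintegral fineK.
    by apply: eq_integral => w _; rewrite mul1r.
  apply: integrable_fin_num => //.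
  apply: (integrable_weight (M := M) hP) => //.
  exact: (measurable_continuous_rV mYr Yr0 cf fM).
(* The Laplace formula of [psi' delta] is available only for positive delta, so finiteness and every
   later identity are asserted near 0 on the right. *)
rewrite limE; apply/fine_cvgP; split.
  near=> delta; have delta_gt0 : 0 < delta by [].
  rewrite /mean_under unlock; apply: integrable_fin_num => //.
  apply: (integrable_weight (M := M) (weight _ delta_gt0)) => //.
    exact: (measurable_continuous_rV (mY delta) (Y0 delta) cf fM).
  by move=> w; exact: fM.
rewrite /mean_under unlock.
have good : \forall delta \near 0^'+,
    [/\ probability_weight (P' delta) (size_weight (psi' delta) a),
      forall k, measurable_fun setT (Y delta k) & forall k w, 0 <= Y delta k w].
  by near=> t; split=> //; exact: weight.
suff cvgL alpha : (forall k, 0 <= alpha k) ->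
    weighted_laplace (P' delta) (size_weight (psi' delta) a) (Y delta) alpha
      @[delta --> 0^'+] --> weighted_laplace P (fun=> 1) Yr alpha.
  have H := laplace_continuity good hP mYr Yr0 cvgL cf fM.
  exact: H.
move=> alpha0.
rewrite [X in _ --> X](_ : _ = levy_moment nu a alpha x / fine (mean_at psi a)); last first.
  rewrite /weighted_laplace /weighted_mean.
  under eq_Rintegral do rewrite mul1r.
  by rewrite /Rintegral (increment_laplace LK ha x hr alpha0).
pose phi := levy_exponent nu alpha x.
have lapE delta : 0 < delta -> expR (- (delta * phi)) *
      (levy_moment nu a alpha x / fine (mean_at psi a)) =
    weighted_laplace (P' delta) (size_weight (psi' delta) a) (Y delta) alpha.
  move=> delta_gt0.
  by rewrite /weighted_laplace /weighted_mean /Rintegral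
    (size_biased_laplace_scaled LK ha x (LK' _ delta_gt0) alpha0).
(* By [lapE] the transform depends on delta only through exp(-delta phi), and phi is a fixed real
   number. *)
have H : - (t * phi) @[t --> 0^'+] --> - (0 * phi).
  by apply: cvgN; apply: cvgMr_tmp; exact: cvg_at_right_filter.
have {}H : expR (- (t * phi)) @[t --> 0^'+] --> (1 : R).
  have := cvg_comp _ _ H (@continuous_expR R (- (0 * phi))).
  by rewrite mul0r oppr0 expR0.
have {}H : expR (- (t * phi)) * (levy_moment nu a alpha x / fine (mean_at psi a))
    @[t --> 0^'+] --> levy_moment nu a alpha x / fine (mean_at psi a).
  by rewrite -[X in _ --> X]mul1r; apply: cvgM => //; exact: cvg_cst.
apply: cvg_trans H; apply: near_eq_cvg; near=> t; exact: lapE.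
Unshelve. all: by end_near. Qed.
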